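(* For $1\le i\le d$ let $(X_i,d_i,m_i)$ be a compact metric space with $m_i$ a $\delta_i$-Ahlfors regular measure, and let $X^\times=\prod_iX_i$ with $d^\times=\max_id_i$ and $m^\times=\prod_im_i$. Let $\bm a=(a_1,\dots,a_d)\in(\mathbb R^+)^d$ with $a_1\le\cdots\le a_d$. Let $\{R_n\}_{n\ge1}$ be rectangles $R_n=\prod_{i=1}^dB(z_{n,i},r_n^{a_i})$ with $r_n\to0$ and $m^\times(\limsup_{n\to\infty}R_n)=m^\times(X^\times)$. Let $\{E_n\}_{n\ge1}$ be open sets with $E_n\subset R_n$ and $|E_n|\le r_n^{a_d}$. Assume there are $c>0$ and $s>0$ with $\mathcal H^s_\infty(E_n)>c\,m^\times(R_n)$ for all $n\ge1$. Then $\limsup_{n\to\infty}E_n\in\mathscr G_1^s(X^\times)$.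
   Context: $m_i$ is $\delta_i$-Ahlfors regular if $m_i(B(x,r))\asymp r^{\delta_i}$ for all $x,r$. $|\cdot|$ denotes diameter in $d^\times$. $\mathcal H^t_\infty(A)=\inf\{\sum_i|B_i|^t: A\subset\bigcup_iB_i,\ B_i\text{ balls in }X^\times\}$. $\mathscr G_1^s(X^\times)$ is the class of $G_\delta$ sets $A\subset X^\times$ for which there is $c>0$ such that $\mathcal H^t_\infty(A\cap B)>c\,\mathcal H^t_\infty(B)$ for all $0<t<s$ and all balls $B\subset X^\times$. *)

(* Defs.v *)
From HB Require Import structures.
From mathcomp Require Import all_boot all_order all_algebra.
From mathcomp Require Import all_classical all_reals all_analysis.
From mathcomp Require Import borel_hierarchy.
Set Implicit Arguments.
Unset Strict Implicit.
Unset Printing Implicit Defensive.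
Import Order.TTheory GRing.Theory Num.Theory.
Import numFieldNormedType.Exports.
Local Open Scope classical_set_scope.
Local Open Scope ring_scope.

(* Base points are needed only because the library's generated sigma-algebras
   live on pointed types; they amount to nonemptiness. *)
#[short(type="pointedMetricType")]
HB.structure Definition PointedMetric (K : numDomainType) :=
  {T of Metric K T & Pointed T}.

Notation borel T := (g_sigma_algebraType (@open T)).

(* The library puts the product topology on dependent products, but no metric
   for a finite index type: this alias carries the maximum metric. *)
Definition maxprod (R : realType) (n : nat)
  (X : 'I_n -> pointedMetricType R) : Type := forall i, X i.

Section maxprod_metric.
Context (R : realType) (n : nat) (X : 'I_n -> pointedMetricType R).

Definition maxdist (x y : maxprod X) : R :=
  \big[Num.max/0]_(i < n) mdist (x i) (y i).

Lemma maxdistxx x : maxdist x x = 0.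
Proof.
by rewrite /maxdist; elim/big_ind: _ => // [_ _ -> ->|i _];
  rewrite ?maxxx ?mdistxx.
Qed.

Lemma mdist_le_maxdist x y i : mdist (x i) (y i) <= maxdist x y.
Proof. by rewrite /maxdist; exact: (le_bigmax _ (fun i => mdist (x i) (y i))). Qed.

Lemma maxdist_positivity x y : maxdist x y = 0 -> x = y.
Proof.
move=> xy; apply: functional_extensionality_dep => i.
apply: mdist_positivity; apply/eqP; rewrite eq_le mdist_ge0 andbT -xy.
exact: mdist_le_maxdist.
Qed.

Lemma maxdist_sym x y : maxdist x y = maxdist y x.
Proof. by apply: eq_bigr => i _; rewrite metric_sym. Qed.

Lemma maxdist_triangle y x z : maxdist x z <= maxdist x y + maxdist y z.
Proof.
apply/bigmax_leP; split=> [|i _].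
  by apply: addr_ge0; exact: bigmax_ge_id.
apply: le_trans (metric_triangle _ (y i) _) _.
by apply: lerD; exact: mdist_le_maxdist.
Qed.

HB.instance Definition _ := gen_eqMixin (maxprod X).
HB.instance Definition _ := gen_choiceMixin (maxprod X).
HB.instance Definition _ := isPointed.Build (maxprod X) (fun=> point).
HB.instance Definition _ := @isMetric.Build R (maxprod X) maxdist
  maxdistxx maxdist_positivity maxdist_sym maxdist_triangle.

End maxprod_metric.

Definition box (R : realType) (n : nat) (X : 'I_n -> pointedMetricType R)
    (A : forall i, set (X i)) : set (maxprod X) :=
  [set x | forall i, A i (x i)].

Definition is_product_measure (R : realType) (n : nat)
    (X : 'I_n -> pointedMetricType R)
    (m : forall i, {measure set (borel (X i)) -> \bar R})
    (mx : {measure set (borel (maxprod X)) -> \bar R}) : Prop :=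
  forall A : forall i, set (X i),
    (forall i, (@open (X i)).-sigma.-measurable (A i)) ->
    mx (box A) = (\prod_(i < n) m i (A i))%E.

(* On a compact space the comparison can only hold for bounded radii; which
   bound is taken is immaterial up to the constant. *)
Definition ahlfors_regular (R : realType) (T : pointedMetricType R)
    (m : {measure set (borel T) -> \bar R}) (delta : R) : Prop :=
  exists C r0 : R, [/\ 0 < C, 0 < r0 & forall (x : T) (r : R), 0 < r <= r0 ->
    ((C^-1 * r `^ delta)%:E <= m (ball x r) <= (C * r `^ delta)%:E)%E].

Section hausdorff_content.
Context (R : realType) (T : metricType R).
Implicit Types (A B : set T) (s t : R).

(* The maximum with 0 only matters for the empty set, since sup set0 = -oo. *)
Definition diam A : \bar R :=
  maxe 0%E (ereal_sup [set (mdist p.1 p.2)%:E | p in A `*` A]).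

Definition is_ball B : Prop := exists x r, 0 < r /\ B = ball x r.

(* Empty members make room for finite covers. *)
Definition ball_cover A : set ((set T)^nat) :=
  [set B | (forall k, B k = set0 \/ is_ball (B k)) /\ A `<=` \bigcup_k B k].

Definition hausdorff_content t A : \bar R :=
  ereal_inf [set (\sum_(0 <= k <oo) (diam (B k) `^ t))%E | B in ball_cover A].

Definition large_intersection_class s : set (set T) :=
  [set A | Gdelta A /\ exists2 c : R, 0 < c &
    forall t, 0 < t < s -> forall B, is_ball B ->
      (c%:E * hausdorff_content t B < hausdorff_content t (A `&` B))%E].

End hausdorff_content.

(* Main.v *)
(* On small balls a measure whose density with respect to the product measure
   is bounded beats every power r^t with t < D = sum delta_i.  Frostman: for E
   open, bumps on balls of a sequence of smaller and smaller scales are added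
   greedily under the constraint nu(B(y,r)) <= r^s; every point of E ends up near
   a saturated ball, and Vitali's covering lemma bounds the content of E by the
   total mass.  In a given ball, the rectangles R_n with n large contain a
   disjoint subfamily of comparable total measure (Vitali again); putting on each
   E_n a Frostman measure of mass comparable to m(R_n) yields a measure nu on the
   ball, carried by the union of the E_n, with
   nu(B(y,r)) <= C (r/rho)^t nu(B(x,rho)) for t < s; this uses
   sum a_i delta_i >= a_d s, which the content hypothesis forces as r_n -> 0.
   Replacing, at a very small scale, a bounded density by such measures changes
   the growth constant by a factor as close to 1 as desired.  Iterating over the
   tails of limsup E_n, the mass distribution principle on the resulting
   decreasing compact sets gives the lower bound, uniformly in t. *)
Require Import Defs.
From mathcomp Require Import all_boot all_order all_algebra.
From mathcomp Require Import all_classical all_reals all_analysis.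
From mathcomp Require Import ring lra.
Import Order.TTheory GRing.Theory Num.Theory.
Import numFieldNormedType.Exports.
Local Open Scope classical_set_scope.
Local Open Scope ring_scope.
Set Implicit Arguments.
Unset Strict Implicit.
Unset Printing Implicit Defensive.

(** * Compact metric spaces and Vitali selection *)

Section metric_facts.
Context (R : realType) (T : pointedMetricType R).
Implicit Types (x y : T) (e r : R) (A : set T).

(** No limit measure is ever formed. In Frostman's lemma, finitely many saturated balls are
    saturated at a common stage of an increasing sequence; in the final lower bound, compactness
    tests each cover against the mass of a single stage. Two invariants, packed in [mass_in], let a
    stage be repeated. A density bounded by G with respect to m gives nu(B(y,r)) <= G Cu r^D, which
    is negligible against r^t below a scale depending on G, because t < D. A closed carrier inside
    an open set leaves room to move mass without leaving that set. The constant with which a tail of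
    limsup E_n spreads mass may depend on t and on the tail. It only decides how small the scale of
    the next replacement has to be and never enters the growth constants, which stay below twice the
    initial one; hence the uniformity in t. The exponent s cannot be given directly to Frostman's
    lemma: only s <= D is known, and a gap above t must pay for passing from the rectangles to the
    ball. An exponent s' strictly between t and s serves both ends. *)

Lemma ball_mdistP x r y : ball x r y <-> mdist x y < r.
Proof. by rewrite ballEmdist. Qed.

Lemma ball_sub x y r r' : mdist x y + r <= r' -> ball y r `<=` ball x r'.
Proof.
move=> h p /ball_mdistP yp; apply/ball_mdistP.
apply: le_lt_trans (metric_triangle _ y _) _.
by apply: lt_le_trans h; rewrite ltrD2l.
Qed.

Lemma open_metricP A : open A <-> forall x, A x -> exists2 e, 0 < e & ball x e `<=` A.
Proof.
split=> [oA x Ax|h].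
  have /nbhs_ballP [e /= e0 H] : nbhs x A by apply: open_nbhs_nbhs.
  by exists e.
rewrite openE => x /h [e e0 H]; rewrite /interior; apply/nbhs_ballP.
by exists e.
Qed.

Lemma open_ball_metric x r : open (ball x r).
Proof.
apply/open_metricP => y /ball_mdistP xy; exists (r - mdist x y).
  by rewrite subr_gt0.
by apply: ball_sub; rewrite addrC subrK.
Qed.

Lemma closed_mdist_le x r : closed [set y | mdist x y <= r].
Proof.
rewrite -openC; apply/open_metricP => y /= /negP; rewrite -ltNge => xy.
exists (mdist x y - r); first by rewrite subr_gt0.
move=> p /ball_mdistP yp /=; apply/negP; rewrite -ltNge.
have := metric_triangle x p y; rewrite (metric_sym p y); lra.
Qed.

Hypothesis cpt : compact [set: T].

(** [P] records why a radius was chosen at a point, so that the finite subcover remembers that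
    reason; each use of compactness below is a choice of [P]. *)
Lemma compact_ball_cover (P : T -> R -> Prop) :
  (forall x, exists2 e, 0 < e & P x e) ->
  exists2 s : seq (T * R), (forall p, p \in s -> 0 < p.2 /\ P p.1 p.2) &
    forall y, exists2 p, p \in s & ball p.1 p.2 y.
Proof.
move=> ex; have /choice [f fP] : forall x, exists e, 0 < e /\ P x e.
  by move=> x; have [e] := ex x; exists e.
have : cover_compact [set: T] by rewrite -compact_cover.
move=> /(_ T setT (fun x => ball x (f x))) [| |D _ cov].
- by move=> x _; exact: open_ball_metric.
- by move=> x _; exists x => //; apply: ballxx; have [] := fP x.
exists [seq (x, f x) | x <- finmap.enum_fset D].
  by move=> p /mapP [x _ ->] /=; have [] := fP x.
move=> y; have [x /= Dx xy] := cov y I.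
by exists (x, f x) => //; apply/mapP; exists x.
Qed.

Lemma finite_net e : 0 < e ->
  exists s : seq T, forall y, exists2 x, x \in s & ball x e y.
Proof.
move=> e0; have [|s sP cov] := compact_ball_cover (P := fun _ r => r = e).
  by move=> x; exists e.
exists [seq p.1 | p <- s] => y; have [p ps py] := cov y.
exists p.1; first by apply/mapP; exists p.
by have [_ <-] := sP _ ps.
Qed.

(** Lebesgue number argument: each radius is chosen so that its double stays in [V] or off [K], and
    [e] is the least of finitely many. A point of [K] rules out the second alternative. *)
Lemma closed_in_open_gap (K V : set T) : closed K -> open V -> K `<=` V ->
  exists2 e, 0 < e & forall x, K x -> ball x e `<=` V.
Proof.
move=> cK oV KV.
have [|s sP cov] := compact_ball_cover
    (P := fun x e => ball x (e + e) `<=` V \/ ball x (e + e) `<=` ~` K).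
  move=> x; have [Kx|Kx] := pselect (K x).
    have [e e0 H] := (open_metricP V).1 oV _ (KV _ Kx).
    by exists (e / 2); [rewrite divr_gt0|left; rewrite -splitr].
  have [e e0 H] := (open_metricP (~` K)).1 (closed_openC cK) _ Kx.
  by exists (e / 2); [rewrite divr_gt0|right; rewrite -splitr].
have [e e0 eP] : exists2 e, 0 < e & forall p, p \in s -> e <= p.2.
  elim: s sP {cov} => [_|p s IH sP]; first by exists 1.
  have [q qs|e e0 eP] := IH; first by apply: sP; rewrite inE qs orbT.
  have [p0 _] := sP p (mem_head _ _).
  exists (Num.min e p.2); first by rewrite lt_min e0.
  by move=> q; rewrite inE => /predU1P [->|/eP qe]; rewrite ge_min ?lexx ?orbT ?qe.
exists e => // x Kx; have [p ps px] := cov x.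
have [_ [pV|pK]] := sP _ ps.
  apply: subset_trans pV; apply: ball_sub.
  by move/ball_mdistP: px => /ltW px; apply: lerD => //; exact: eP.
case: (pK x) => //; apply: le_ball px.
have [p0 _] := sP _ ps; lra.
Qed.

(** Each point has a ball inside one [B n] or missing one [C n]; by monotonicity an index above the
    finitely many ones involved serves for both. Thus an open cover of the intersection already
    covers one stage. *)
Lemma compact_nested_cover (C B : nat -> set T) :
  (forall n, closed (C n)) -> (forall n k, (n <= k)%N -> C k `<=` C n) ->
  (forall n, open (B n)) -> \bigcap_n C n `<=` \bigcup_n B n ->
  exists n, C n `<=` \bigcup_(i < n) B i.
Proof.
move=> cC dC oB CB.
have [|s sP cov] := compact_ball_cover
    (P := fun x e => exists n, ball x e `<=` B n \/ ball x e `<=` ~` C n).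
  move=> x; have [[n _ Bx]|Bx] := pselect ((\bigcup_n B n) x).
    by have [e e0 H] := (open_metricP _).1 (oB n) _ Bx; exists e => //; exists n; left.
  have [n Cx] : exists n, ~ C n x.
    by apply/existsNP => Cx; apply: Bx; apply: CB => n _; exact: Cx.
  have [e e0 H] := (open_metricP _).1 (closed_openC (cC n)) _ Cx.
  by exists e => //; exists n; right.
have [N NP] : exists N, forall p, p \in s -> exists2 n, (n < N)%N &
    ball p.1 p.2 `<=` B n \/ ball p.1 p.2 `<=` ~` C n.
  elim: s sP {cov} => [_|p s IH sP]; first by exists 0%N.
  have [q qs|N NP] := IH; first by apply: sP; rewrite inE qs orbT.
  have [_ [n nP]] := sP p (mem_head _ _).
  exists (maxn N n.+1) => q; rewrite inE => /predU1P [->|/NP [k kN kP]].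
    by exists n => //; rewrite leq_max ltnSn orbT.
  by exists k => //; rewrite leq_max kN.
exists N => y CNy; have [p ps py] := cov y.
have [n nN [pB|pC]] := NP _ ps; first by exists n => //; exact: pB.
by case: (pC y py); apply: dC CNy; exact: ltnW.
Qed.

End metric_facts.

Section vitali_selection.
Context (R : realType) (I : Type).

(* Greedy selection: at each step pick an element of almost maximal size among
   those meeting none of the elements already selected. *)
Lemma vitali_selection (F : I -> Prop) (g : I -> R) (meet : I -> I -> Prop) :
  (forall i, F i -> 0 < g i) ->
  (exists M, forall i, F i -> g i <= M) ->
  (forall t, 0 < t -> exists N : nat, forall u : nat -> I,
     (forall n, (n < N)%N -> F (u n) /\ t <= g (u n)) ->
     exists n m, (m < n < N)%N /\ meet (u n) (u m)) ->
  exists u : nat -> option I,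
    [/\ forall n i, u n = Some i -> F i,
        forall n m i j, (m < n)%N -> u n = Some i -> u m = Some j -> ~ meet i j &
        forall i, F i -> exists n j, [/\ u n = Some j, meet i j & g i <= 2 * g j]].
Proof.
move=> g0 [M gM] fin.
pose free (s : seq I) i := F i /\ forall j, List.In j s -> ~ meet i j.
have sel s : exists o : option I, match o with
    | None => forall i, ~ free s i
    | Some j => free s j /\ forall i, free s i -> g i <= 2 * g j end.
  have [[i0 Fi0]|no] := pselect (exists i, free s i); last first.
    by exists None => i Fi; apply: no; exists i.
  pose S := [set g i | i in [set i | free s i]].
  have S0 : has_sup S.
    split; first by exists (g i0); exists i0.
    by exists M => _ [i [Fi _] <-]; exact: gM.
  have supS0 : 0 < sup S.
    apply: lt_le_trans (g0 _ Fi0.1) _.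
    by apply: ub_le_sup; [case: S0|exists i0].
  have [|_ [j Fj <-] jP] := @sup_adherent _ S (sup S / 2) _ S0.
    by rewrite divr_gt0.
  exists (Some j); split => // i Fi.
  have : g i <= sup S by apply: ub_le_sup; [case: S0|exists i].
  lra.
have [f fP] := choice sel.
pose L := fix L n := if n is n'.+1 then
  (if f (L n') is Some j then j :: L n' else L n') else [::].
pose u n := f (L n).
have LS n : L n.+1 = (if u n is Some j then j :: L n else L n) by [].
have inL n m j : (m < n)%N -> u m = Some j -> List.In j (L n).
  elim: n => // n IH; rewrite ltnS leq_eqVlt => /predU1P [->|mn] uj.
    by rewrite LS uj; left.
  by rewrite LS; case: (u n) => [k|]; [right|]; exact: IH.
have Lu n j : List.In j (L n) -> exists m, u m = Some j.
  elim: n => // n IH; rewrite LS; case E : (u n) => [k|]; last exact: IH.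
  by case=> [<-|/IH //]; exists n.
exists u; split.
- by move=> n i ui; have := fP (L n); rewrite -/(u n) ui => -[[]].
- move=> n m i j mn ui uj; have := fP (L n); rewrite -/(u n) ui => -[[_ +] _].
  by apply; exact: inL uj.
move=> i Fi.
have [N NP] : exists N, ~ free (L N) i.
  apply/existsNP => fr.
  have ex n : exists j, u n = Some j.
    case E : (u n) => [j|]; first by exists j.
    by have := fP (L n); rewrite -/(u n) E => /(_ i) [].
  have [v vP] := choice ex.
  (* As long as [i] is free, every selected element has size at least [g i / 2], and [fin] bounds
     how many of these can avoid one another. *)
  have [|N /(_ v) [|n [m [/andP [mn _] nm]]]] := fin (g i / 2).
  - by rewrite divr_gt0 ?g0.
  - move=> n _; have := fP (L n); rewrite -/(u n) vP => -[[Fv _] /(_ i (fr n))].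
    by split => //; lra.
  have := fP (L n); rewrite -/(u n) vP => -[[_ /(_ (v m))] +] _.
  by apply => //; apply: inL (vP m).
have {NP} : exists n, (forall m, (m <= n)%N -> free (L m) i) /\ ~ free (L n.+1) i.
  elim: N NP => [[]|N IH NP]; first by split.
  have [h|h] := pselect (free (L N) i); last exact: IH.
  have [[m [mN nm]]|no] := pselect (exists m, (m <= N)%N /\ ~ free (L m) i).
    case: nm; split=> // j jm; have [_] := h; apply.
    elim: N mN {IH NP h} => [|N IH]; first by rewrite leqn0 => /eqP mE; rewrite mE in jm.
    rewrite leq_eqVlt => /predU1P [mE|mN]; first by rewrite mE in jm.
    by rewrite LS; case: (u N) => [k|]; [right|]; apply: IH.
  by exists N; split => // m mN; apply: contrapT => nm; apply: no; exists m.
move=> [n [/(_ n (leqnn n)) fr nfr]].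
case E : (u n) => [j|]; last by case: nfr; rewrite LS E.
exists n, j; split => //.
  apply: contrapT => nm; apply: nfr; split=> // k; rewrite LS E.
  by case=> [<- //|]; exact: fr.2.
by have := fP (L n); rewrite -/(u n) E => -[_ /(_ i fr)].
Qed.

End vitali_selection.

(** * Set functions with bounded density and Hausdorff content *)

Section masses.
Context (R : realType) (T : pointedMetricType R).
Implicit Types (nu : set T -> R) (A B O : set T).

Definition borel_set A := @measurable _ (borel T) A.

(* Finite additivity is all that is needed of the measures constructed below. *)
Definition mass nu :=
  (forall A, borel_set A -> 0 <= nu A) /\
  (forall A B, borel_set A -> borel_set B -> A `&` B = set0 ->
     nu (A `|` B) = nu A + nu B).

Lemma borel_open A : open A -> borel_set A.
Proof. by move=> oA; apply: sub_sigma_algebra. Qed.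

Lemma borel_ball x (r : R) : borel_set (ball x r).
Proof. by apply: borel_open; exact: open_ball_metric. Qed.

Lemma borel_setC A : borel_set A -> borel_set (~` A).
Proof. exact: measurableC. Qed.

Lemma borel_closed A : closed A -> borel_set A.
Proof.
move=> cA; rewrite -[A]setCK; apply: borel_setC; apply: borel_open.
exact: closed_openC.
Qed.

Lemma borel_setT : borel_set setT.
Proof. exact: measurableT. Qed.

Lemma borel_set0 : borel_set set0.
Proof. exact: measurable0. Qed.

Lemma borel_setI A B : borel_set A -> borel_set B -> borel_set (A `&` B).
Proof. exact: measurableI. Qed.

Lemma borel_setU A B : borel_set A -> borel_set B -> borel_set (A `|` B).
Proof. exact: measurableU. Qed.

Lemma borel_setD A B : borel_set A -> borel_set B -> borel_set (A `\` B).
Proof. exact: measurableD. Qed.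

Section mass_facts.
Variable nu : set T -> R.
Hypothesis nuP : mass nu.

Lemma mass_ge0 A : borel_set A -> 0 <= nu A.
Proof. exact: nuP.1. Qed.

Lemma mass_set0 : nu set0 = 0.
Proof.
have := nuP.2 _ _ borel_set0 borel_set0; rewrite set0I setU0 => /(_ erefl).
by lra.
Qed.

Lemma mass_split B A : borel_set A -> borel_set B ->
  nu A = nu (A `&` B) + nu (A `\` B).
Proof.
move=> mA mB; rewrite -nuP.2 ?setUIDK //.
- exact: borel_setI.
- exact: borel_setD.
- by rewrite setDE setIACA setICr setI0.
Qed.

Lemma le_mass A B : borel_set A -> borel_set B -> A `<=` B -> nu A <= nu B.
Proof.
move=> mA mB AB; rewrite (mass_split (A := B) mB mA) (setIidr AB) lerDl.
by apply: mass_ge0; exact: borel_setD.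
Qed.

Lemma mass_setU_le A B : borel_set A -> borel_set B -> nu (A `|` B) <= nu A + nu B.
Proof.
move=> mA mB; rewrite (mass_split (A := A `|` B) (borel_setU mA mB) mA).
rewrite setUK; apply: lerD => //; apply: le_mass => //.
  by apply: borel_setD => //; exact: borel_setU.
by move=> x [[]].
Qed.

Lemma mass_disjoint_support K A : borel_set K -> nu (~` K) = 0 ->
  borel_set A -> A `&` K = set0 -> nu A = 0.
Proof.
move=> mK nuK mA AK; apply/eqP; rewrite eq_le mass_ge0 // andbT -nuK.
apply: le_mass => //; first exact: borel_setC.
by move=> x Ax Kx; have : (A `&` K) x by []; rewrite AK.
Qed.

Lemma mass_bigcup_le (B : nat -> set T) n : (forall i, borel_set (B i)) ->
  borel_set (\bigcup_(i < n) B i) /\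
  nu (\bigcup_(i < n) B i) <= \sum_(i < n) nu (B i).
Proof.
move=> mB; elim: n => [|n [IHm IH]].
  by rewrite bigcup_mkord !big_ord0 mass_set0; split => //; exact: borel_set0.
rewrite bigcup_mkord !big_ord_recr /= -bigcup_mkord; split.
  exact: borel_setU.
by apply: le_trans (mass_setU_le _ _) _ => //; rewrite lerD2r.
Qed.

Lemma mass_sum_disjoint (B : nat -> set T) (O : set T) n :
  (forall i, borel_set (B i)) -> borel_set O -> (forall i, (i < n)%N -> B i `<=` O) ->
  (forall i j, (j < i < n)%N -> B i `&` B j = set0) ->
  \sum_(i < n) nu (B i) <= nu O.
Proof.
move=> mB mO BO dB.
have {}BO : \bigcup_(i < n) B i `<=` O by apply: bigcup_sub => i; exact: BO.
apply: le_trans (le_mass (mass_bigcup_le n mB).1 mO BO).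
elim: n dB {BO} => [_|n IH dB].
  by rewrite big_ord0 bigcup_mkord big_ord0 mass_set0.
rewrite bigcup_mkord !big_ord_recr /= -bigcup_mkord nuP.2 //.
- rewrite lerD2r; apply: IH => i j /andP [ji iN].
  by apply: dB; rewrite ji /= ltnS ltnW.
- exact: (mass_bigcup_le n mB).1.
- rewrite setI_bigcupl bigcup0 // => i /= iN; rewrite setIC; apply: dB.
  by rewrite iN /=.
Qed.

End mass_facts.

Definition growth nu (a t : R) := forall x r, 0 < r -> nu (ball x r) <= a * r `^ t.

Variable m : set T -> R.
Hypothesis mP : mass m.

(** The density bound gives decay of order r^D at small scales, with no control on the constant; the
    closed carrier has, by compactness, a positive distance from the complement of an open [O]. *)
Definition mass_in O nu := [/\ mass nu,
  exists2 G, 0 <= G & forall A, borel_set A -> nu A <= G * m A &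
  exists K, [/\ closed K, K `<=` O & nu (~` K) = 0]].

Lemma mass_inS O O' nu : O `<=` O' -> mass_in O nu -> mass_in O' nu.
Proof.
move=> OO' [? ? [K [cK KO K0]]]; split=> //; exists K; split => //.
exact: subset_trans OO'.
Qed.

Lemma mass_in0 O : mass_in O (fun=> 0).
Proof.
split; first by split=> // *; rewrite addr0.
  by exists 0 => // A mA; rewrite mul0r.
by exists set0; split => //; exact: closed0.
Qed.

Lemma mass_inD O nu nu' : mass_in O nu -> mass_in O nu' ->
  mass_in O (fun A => nu A + nu' A).
Proof.
move=> [P [G G0 GP] [K [cK KO K0]]] [P' [G' G'0 GP'] [K' [cK' KO' K0']]]; split.
- split=> [A mA|A B mA mB AB]; first by rewrite addr_ge0 ?mass_ge0.
  by rewrite P.2 // P'.2 // addrACA.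
- exists (G + G'); first exact: addr_ge0.
  by move=> A mA; rewrite mulrDl lerD ?GP ?GP'.
- exists (K `|` K'); split; first exact: closedU.
    by rewrite subUset.
  have mK := borel_closed cK; have mK' := borel_closed cK'.
  have mKU : borel_set (~` (K `|` K')) by apply: borel_setC; apply: borel_setU.
  rewrite (mass_disjoint_support P mK K0) // ?(mass_disjoint_support P' mK' K0') ?addr0 //.
    by rewrite setCU -setIA setICl setI0.
  by rewrite setCU setIAC setICl set0I.
Qed.

Lemma mass_inZ O nu c : 0 <= c -> mass_in O nu -> mass_in O (fun A => c * nu A).
Proof.
move=> c0 [P [G G0 GP] [K [cK KO K0]]]; split.
- split=> [A mA|A B mA mB AB]; first by rewrite mulr_ge0 ?mass_ge0.
  by rewrite P.2 // mulrDr.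
- exists (c * G); first exact: mulr_ge0.
  by move=> A mA; rewrite -mulrA ler_wpM2l ?GP.
- by exists K; split=> //; rewrite K0 mulr0.
Qed.

Definition bump x (r : R) A := m (A `&` ball x r) / m (ball x r).

Lemma bump_in O x r : 0 < m (ball x r) -> [set y | mdist x y <= r] `<=` O ->
  mass_in O (bump x r).
Proof.
move=> m0 rO; have mb := borel_ball x r; split.
- split=> [A mA|A B mA mB AB].
    by rewrite divr_ge0 ?(ltW m0) // mass_ge0 //; exact: borel_setI.
  rewrite /bump setIUl mP.2 ?mulrDl //; [exact: borel_setI..|].
  by rewrite setIACA AB set0I.
- exists (m (ball x r))^-1; first by rewrite invr_ge0 ltW.
  move=> A mA; rewrite /bump mulrC ler_wpM2l ?invr_ge0 ?(ltW m0) //.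
  apply: le_mass => //; first exact: borel_setI.
- exists [set y | mdist x y <= r]; split => //; first exact: closed_mdist_le.
  rewrite /bump (_ : _ `&` _ = set0) ?mass_set0 ?mul0r //.
  by rewrite -subset0 => y [/=] + /ball_mdistP /ltW.
Qed.

Lemma bump_full A x r : 0 < m (ball x r) -> ball x r `<=` A -> bump x r A = 1.
Proof. by move=> m0 rA; rewrite /bump setIidr // divff // gt_eqF. Qed.

Lemma bump_disjoint A x r : A `&` ball x r = set0 -> bump x r A = 0.
Proof. by move=> h; rewrite /bump h mass_set0 // mul0r. Qed.

Lemma bump_le1 A x r : borel_set A -> 0 < m (ball x r) -> bump x r A <= 1.
Proof.
move=> mA m0; rewrite ler_pdivrMr // mul1r; have mb := borel_ball x r.
by apply: le_mass => //; exact: borel_setI.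
Qed.

Lemma bump_ge0 A x r : borel_set A -> 0 < m (ball x r) -> 0 <= bump x r A.
Proof.
move=> mA m0; rewrite divr_ge0 ?(ltW m0) //; apply: mass_ge0 => //.
by apply: borel_setI => //; exact: borel_ball.
Qed.

End masses.

(** * Diameters and Hausdorff content *)

Section content.
Context (R : realType) (T : pointedMetricType R).
Implicit Types (A : set T) (B : nat -> set T) (x y : T) (r t M : R).

Lemma diam_ge0 A : (0 <= diam A)%E.
Proof. by rewrite le_max lexx. Qed.

Lemma mdist_le_diam A x y : A x -> A y -> ((mdist x y)%:E <= diam A)%E.
Proof.
move=> Ax Ay; rewrite le_max; apply/orP; right.
by apply: ereal_sup_ubound; exists (x, y).
Qed.

Lemma diam_le A r : 0 <= r -> (forall x y, A x -> A y -> mdist x y <= r) ->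
  (diam A <= r%:E)%E.
Proof.
move=> r0 h; rewrite ge_max lee_fin r0 /=; apply: ub_ereal_sup.
by move=> _ [[x y] [/= Ax Ay] <-]; rewrite lee_fin h.
Qed.

Lemma diam_ball_le x r : 0 < r -> (diam (ball x r) <= (2 * r)%:E)%E.
Proof.
move=> r0; apply: diam_le; first by rewrite mulr_ge0 // ltW.
move=> y z /ball_mdistP xy /ball_mdistP xz.
have := metric_triangle y x z; rewrite (metric_sym y x); lra.
Qed.

Lemma diam_set0 : diam (set0 : set T) = 0%E.
Proof.
by apply/eqP; rewrite eq_le diam_ge0 andbT; apply: diam_le.
Qed.

Definition empty_or_ball A := A = set0 \/ Defs.is_ball A.

Lemma diam_fin A : empty_or_ball A -> diam A = (fine (diam A))%:E.
Proof.
move=> [->|[x [r [r0 ->]]]]; first by rewrite diam_set0.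
rewrite fineK // ge0_fin_numE ?diam_ge0 //.
by apply: le_lt_trans (diam_ball_le x r0) _; rewrite ltry.
Qed.

Lemma content_le t M A B (w : nat -> R) :
  (forall k, empty_or_ball (B k)) -> A `<=` \bigcup_k B k ->
  (forall k, (diam (B k) `^ t <= (w k)%:E)%E) ->
  (forall n, \sum_(k < n) w k <= M) ->
  (hausdorff_content t A <= M%:E)%E.
Proof.
move=> Bb AB Bw wM; apply: ereal_inf_le.
exists (\sum_(0 <= k <oo) (diam (B k) `^ t))%E; first by exists B.
apply: lime_le; first by apply: is_cvg_nneseries => *; exact: poweR_ge0.
near=> n; rewrite (le_trans (lee_sum _ (fun i _ => Bw i))) //.
by rewrite sumEFin lee_fin big_mkord.
Unshelve. all: by end_near. Qed.

(** A partial sum suffices since the terms are nonnegative; [n] may depend on the cover, which is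
    where a finite subcover enters. *)
Lemma content_ge t M A :
  (forall B, (forall k, empty_or_ball (B k)) -> A `<=` \bigcup_k B k ->
     exists n, M <= \sum_(k < n) fine (diam (B k)) `^ t) ->
  (M%:E <= hausdorff_content t A)%E.
Proof.
move=> h; apply: le_ereal_inf_tmp => _ [B [Bb AB] <-].
have [n nM] := h B Bb AB.
apply: le_trans (nneseries_lim_ge n _); last by move=> *; exact: poweR_ge0.
rewrite big_mkord; under eq_bigr do rewrite diam_fin // poweR_EFin.
by rewrite sumEFin lee_fin.
Qed.

Lemma content_ball_le t x r : 0 < t -> 0 < r ->
  (hausdorff_content t (ball x r) <= ((fine (diam (ball x r))) `^ t)%:E)%E.
Proof.
move=> t0 r0; have bb : empty_or_ball (ball x r) by right; exists x, r.
apply: (content_le (B := fun k => if k is 0%N then ball x r else set0)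
  (w := fun k => if k is 0%N then fine (diam (ball x r)) `^ t else 0)).
- by case=> [|k]; [|left].
- by move=> y xy; exists 0%N.
- case=> [|k]; first by rewrite diam_fin.
  (* Here [0 < t] is essential: 0 to the power 0 is 1, so with exponent 0 the empty members would
     have a cost. *)
  by rewrite diam_set0 poweR_EFin powR0 // gt_eqF.
- case=> [|n]; first by rewrite big_ord0 powR_ge0.
  by rewrite big_ord_recl big1 ?addr0.
Qed.

Lemma le_content t A A' : A `<=` A' ->
  (hausdorff_content t A <= hausdorff_content t A')%E.
Proof.
move=> AA'; apply: ereal_inf_le_tmp => _ [B [Bb AB] <-].
by exists B => //; split => //; exact: subset_trans AB.
Qed.

End content.

Section powers.
Context (R : realType).
Implicit Types (x y t : R).

Lemma le_powR x y t : 0 <= t -> 0 <= x -> x <= y -> x `^ t <= y `^ t.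
Proof.
by move=> t0 x0 xy; apply: ge0_ler_powR; rewrite // nnegrE // (le_trans x0).
Qed.

Lemma powR_small t e : 0 < t -> 0 < e ->
  exists2 x0, 0 < x0 & forall x, 0 <= x <= x0 -> x `^ t <= e.
Proof.
move=> t0 e0; exists (e `^ t^-1); first exact: powR_gt0.
move=> x /andP [x0 /(le_powR (ltW t0) x0)].
by rewrite -powRrM mulVf ?gt_eqF // powRr1 // ltW.
Qed.

Lemma powRDgt0 x t u : 0 < x -> x `^ (t + u) = x `^ t * x `^ u.
Proof. by move=> x0; rewrite powRD // (gt_eqF x0) implybT. Qed.

Lemma powR_div x y t : 0 <= x -> 0 < y -> (x / y) `^ t = x `^ t / y `^ t.
Proof.
move=> x0 y0; have yt := powR_gt0 t y0; apply: (mulIf (lt0r_neq0 yt)).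
by rewrite -powRM ?divr_ge0 ?(ltW y0) // !divfK ?gt_eqF.
Qed.

End powers.

Lemma nat_last_true (P : nat -> Prop) N : P 0%N -> ~ P N ->
  exists k, P k /\ ~ P k.+1.
Proof.
move=> P0; elim: N => [/(_ P0) []|N IH nP].
by have [PN|/IH //] := pselect (P N); exists N.
Qed.

Lemma eventually_all_below (P : nat -> nat -> Prop) N :
  (forall n, exists k, P n k) -> (forall n k l, (k <= l)%N -> P n k -> P n l) ->
  exists k, forall n, (n < N)%N -> P n k.
Proof.
move=> ex mono; elim: N => [|N [k kP]]; first by exists 0%N.
have [l lP] := ex N; exists (maxn k l) => n; rewrite ltnS leq_eqVlt.
case/predU1P => [->|nN]; first by apply: mono lP; exact: leq_maxr.
by apply: mono (kP _ nN); exact: leq_maxl.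
Qed.

(** * Frostman's lemma for open sets *)

Section ahlfors_space.
Context (R : realType) (T : pointedMetricType R).
Variables (m : set T -> R) (D Cu cl Q r0 : R).
Hypotheses (cpt : compact [set: T]) (mP : mass m)
  (cl_gt0 : 0 < cl) (r0_gt0 : 0 < r0) (Q_ge1 : 1 <= Q) (CuE : Cu = Q * cl)
  (m_up : forall x r, 0 < r -> m (ball x r) <= Cu * r `^ D)
  (m_lo : forall x r, 0 < r <= r0 -> cl * r `^ D <= m (ball x r)).

Lemma Q_gt0 : 0 < Q.
Proof. exact: lt_le_trans Q_ge1. Qed.

Lemma m_ball_gt0 x r : 0 < r <= r0 -> 0 < m (ball x r).
Proof.
move=> rr; apply: lt_le_trans (m_lo x rr).
by rewrite mulr_gt0 // powR_gt0; case/andP: rr.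
Qed.

Lemma bump_ball_le x y sg r : 0 < sg <= r0 -> 0 < r ->
  bump m x sg (ball y r) <= Q * (r / sg) `^ D.
Proof.
move=> sg0 rr; have s0 : 0 < sg by case/andP: sg0.
rewrite ler_pdivrMr ?m_ball_gt0 //.
have h1 : m (ball y r `&` ball x sg) <= Cu * r `^ D.
  apply: le_trans (m_up y rr); apply: le_mass => //;
    [apply: borel_setI|]; exact: borel_ball.
apply: (le_trans h1); rewrite -{1}(divfK (lt0r_neq0 s0) r).
rewrite powRM ?divr_ge0 ?(ltW s0) ?(ltW rr) //.
have -> : Cu * ((r / sg) `^ D * sg `^ D) = Q * (r / sg) `^ D * (cl * sg `^ D).
  by rewrite CuE; ring.
by apply: ler_wpM2l (m_lo x sg0); rewrite mulr_ge0 ?powR_ge0 // ltW ?Q_gt0.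
Qed.

(** Both sides are linear in [beta], so the property passes to nonnegative combinations of bumps.
    The factor 3 is there because a ball of radius [sg] meeting [ball y r], with [r < sg], lies in
    [ball y (3 * sg)]. *)
Definition locally_spread sg (beta : set T -> R) := forall y r, 0 < r < sg ->
  beta (ball y r) <= Q * (r / sg) `^ D * beta (ball y (3 * sg)).

Lemma locally_spread_bump x sg : 0 < sg <= r0 -> locally_spread sg (bump m x sg).
Proof.
move=> sg0 y r /andP [rr rsg]; have mb := m_ball_gt0 x sg0.
have Q0 : 0 <= Q * (r / sg) `^ D by rewrite mulr_ge0 ?powR_ge0 // ltW ?Q_gt0.
have [h|/set0P [p [/ball_mdistP yp /ball_mdistP xp]]] := eqVneq (ball y r `&` ball x sg) set0.
  rewrite bump_disjoint // mulr_ge0 // bump_ge0 //; exact: borel_ball.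
rewrite [X in _ * X]bump_full ?mulr1 ?bump_ball_le //.
apply: ball_sub; have := metric_triangle y p x; rewrite (metric_sym p x); lra.
Qed.


Variable s : R.
Hypotheses (s_gt0 : 0 < s) (sD : s < D).

(** Chosen so that kappa (3 sg)^s equals sg^s / (4 Q), the step by which multiples of a bump are
    increased. *)
Definition kappa := (4 * Q * 3 `^ s)^-1.

Lemma kappa_gt0 : 0 < kappa.
Proof. by rewrite invr_gt0 !mulr_gt0 ?Q_gt0 ?powR_gt0. Qed.

Lemma kappa_le : kappa <= 4^-1.
Proof.
have h3 : 1 <= 3 `^ s.
  have : 1 `^ s <= 3 `^ s by apply: le_powR; rewrite ?ltW //; lra.
  by rewrite powR1.
rewrite lef_pV2 ?posrE ?mulr_gt0 ?Q_gt0 ?powR_gt0 // -mulrA ler_peMr //.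
by rewrite -[leLHS]mulr1; apply: ler_pM.
Qed.

(* Adding a multiple of the bump at [x] until some ball can take no more: the
   blocking ball may be smaller than the bump, but then, [s] being smaller than
   [D], the ball of radius [3 * sg] around it is saturated as well. *)
Lemma saturate_bumps O (mu : set T -> R) sg (xs : seq T) :
  0 < sg <= r0 -> mass mu -> growth mu 1 s ->
  (forall y r, 0 < r < sg -> mu (ball y r) <= r `^ s / 2) ->
  (forall x, x \in xs -> [set y | mdist x y <= sg] `<=` O) ->
  exists beta, [/\ mass_in m O beta, growth (fun A => mu A + beta A) 1 s,
    locally_spread sg beta &
    forall x, x \in xs -> exists y r, [/\ 0 < r, ball x sg `<=` ball y (3 * r) &
      kappa * r `^ s <= mu (ball y r) + beta (ball y r)]].
Proof.
move=> sg0 muP mug half; have s0 : 0 < sg by case/andP: sg0.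
have Q0 := Q_gt0.
elim: xs => [_|x xs IH xO].
  exists (fun=> 0); split => //; first exact: mass_in0.
    by move=> y r rr; rewrite addr0; exact: mug.
  by move=> y r rr; rewrite mulr0.
have [|beta [bin bg bs bsat]] := IH.
  by move=> z zxs; apply: xO; rewrite inE zxs orbT.
have mb := m_ball_gt0 x sg0.
pose h := sg `^ s / (4 * Q); pose bx := bump m x sg.
have ss0 : 0 < sg `^ s by exact: powR_gt0.
have h0 : 0 < h by rewrite divr_gt0 // mulr_gt0.
have hs : h <= sg `^ s / 4.
  by rewrite ler_pM2l // lef_pV2 ?posrE ?mulr_gt0 // ler_peMr // Q_ge1.
have bx_in : mass_in m O bx by apply: bump_in => //; apply: xO; exact: mem_head.
pose bet k A := beta A + (k%:R * h) * bx A.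
(* The largest admissible number of steps. It exists because after more than 4 Q steps [ball x sg]
   alone carries more than sg^s. *)
have [k [kf kn]] : exists k, growth (fun A => mu A + bet k A) 1 s /\
    ~ growth (fun A => mu A + bet k.+1 A) 1 s.
  have [M M4] : exists M : nat, 4 * Q < M%:R.
    by exists (Num.truncn (4 * Q)).+1; rewrite truncnS_gt.
  apply: (@nat_last_true _ M).
    by move=> y r rr; rewrite /bet mul0r mul0r addr0; exact: bg.
  move=> /(_ x sg s0); apply/negP; rewrite -ltNge mul1r /bet /bx bump_full //.
  apply: (@lt_le_trans _ _ (M%:R * h)).
    rewrite /h mulrC -mulrA ltr_pMr // mulrC ltr_pdivlMr ?mul1r // mulr_gt0 //.
  rewrite mulr1; have := mass_ge0 muP (borel_ball x sg).
  have [bP _ _] := bin; have := mass_ge0 bP (borel_ball x sg); lra.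
have kh0 : 0 <= k%:R * h by rewrite mulr_ge0 // ltW.
have bk_in : mass_in m O (bet k) by apply: mass_inD => //; exact: mass_inZ.
have [[bP _ _] [bkP _ _] [bxP _ _]] := And3 bin bk_in bx_in.
have bks : locally_spread sg (bet k).
  move=> y r rr; rewrite /bet mulrDr lerD ?bs // [leRHS]mulrCA ler_wpM2l //.
  exact: locally_spread_bump.
exists (bet k); split => // z; rewrite inE => /predU1P [->{z}|/bsat]; last first.
  move=> [y [r [rr zy sat]]]; exists y, r; split => //; apply: le_trans sat _.
  by rewrite lerD2l lerDl mulr_ge0 // mass_ge0 //; exact: borel_ball.
move/existsNP: kn => [y /existsNP [r]]; rewrite not_implyE => -[rr].
have betS A : bet k.+1 A = bet k A + h * bx A by rewrite /bet -natr1; ring.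
move/negP; rewrite -ltNge mul1r betS addrA => over.
have [p [/ball_mdistP yp /ball_mdistP xp]] : ball y r `&` ball x sg !=set0.
  apply/set0P/eqP => dis; move: over; rewrite ltNge => /negP; apply.
  by rewrite /bx bump_disjoint // mulr0 addr0; have := kf y r rr; rewrite mul1r.
have xy : mdist y x < r + sg.
  by have := metric_triangle y p x; rewrite (metric_sym p x); lra.
have mbk A : borel_set A -> 0 <= mu A + bet k A.
  by move=> mA; rewrite addr_ge0 ?mass_ge0.
(* A blocking ball at least as large as the bump is itself saturated: the overshooting step is worth
   at most a quarter of r^s. *)
have [sgr|rsg] := leP sg r.
  exists y, r; split => //; first by apply: ball_sub; lra.
  have hb : h * bx (ball y r) <= h.
    rewrite ler_piMr ?(ltW h0) //; apply: bump_le1 => //; exact: borel_ball.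
  have sr : sg `^ s <= r `^ s by apply: le_powR => //; exact: ltW.
  have kr : kappa * r `^ s <= 4^-1 * r `^ s.
    by rewrite ler_wpM2r ?powR_ge0 // kappa_le.
  lra.
exists y, (3 * sg); split; first by rewrite mulr_gt0.
  by apply: ball_sub; lra.
have rsg' : 0 < r < sg by rewrite rr.
pose q := (r / sg) `^ s.
have q0 : 0 < q by rewrite powR_gt0 // divr_gt0.
have qD : (r / sg) `^ D <= q.
  by apply: ger_powR (ltW sD); rewrite divr_gt0 //= ler_pdivrMr // mul1r ltW.
have qE : r `^ s = q * sg `^ s.
  rewrite -powRM ?divr_ge0 ?(ltW s0) ?(ltW rr) //.
  by rewrite divfK // gt_eqF.
have L0 : 0 <= bet k (ball y (3 * sg)) by apply: mass_ge0 => //; exact: borel_ball.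
have b1 : bet k (ball y r) <= Q * q * bet k (ball y (3 * sg)).
  apply: le_trans (bks y r rsg') _; rewrite ler_wpM2r // ler_wpM2l //.
  exact: ltW.
have b2 : h * bx (ball y r) <= h * (Q * q).
  rewrite ler_wpM2l ?(ltW h0) //; apply: le_trans (bump_ball_le x y sg0 rr) _.
  by rewrite ler_wpM2l // ltW.
have b3 := half y r rsg'.
(* [mu] takes at most half of r^s = q sg^s, so the bumps, overshooting step included, take more than
   the other half. Passing to radius [3 * sg] costs the factor Q q, and the last step accounts for Q
   h = sg^s / 4; what remains forces the mass of [ball y (3 * sg)] above [h]. *)
have b4 : q * (sg `^ s / 2) < q * (Q * (bet k (ball y (3 * sg)) + h)).
  rewrite qE in over b3.
  have -> : q * (Q * (bet k (ball y (3 * sg)) + h)) =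
    Q * q * bet k (ball y (3 * sg)) + h * (Q * q) by ring.
  have -> : q * (sg `^ s / 2) = q * sg `^ s - q * sg `^ s / 2 by field.
  lra.
rewrite ltr_pM2l // in b4.
have -> : kappa * (3 * sg) `^ s = h.
  rewrite powRM ?(ltW s0) // /kappa /h; field.
  by rewrite !gt_eqF // powR_gt0.
have Qh : Q * h = sg `^ s / 4 by rewrite /h; field; rewrite gt_eqF.
have : Q * h < Q * bet k (ball y (3 * sg)) by lra.
rewrite ltr_pM2l // => /ltW hb; apply: le_trans hb _.
by rewrite lerDr mass_ge0 //; exact: borel_ball.
Qed.


(** Bounded density decays like r^D with D > s: below a scale depending only on the density bound,
    half of the permitted growth is still free for new bumps. The [+ 1] in the constants covers
    [G = 0]. *)
Lemma fine_scale G b : 0 <= G -> 0 < b -> exists2 sg, 0 < sg <= b &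
  forall nu : set T -> R, (forall A, borel_set A -> nu A <= G * m A) ->
  forall y r, 0 < r <= sg -> nu (ball y r) <= r `^ s / 2.
Proof.
move=> G0 b0; have GC0 : 0 <= G * Cu by rewrite mulr_ge0 // CuE ltW // mulr_gt0 // Q_gt0.
have GC : 0 < G * Cu + 1 by rewrite ltr_wpDl.
have [|//|x0 x00 x0P] := @powR_small R (D - s) (2 * (G * Cu + 1))^-1.
- by rewrite subr_gt0.
- by rewrite invr_gt0 mulr_gt0.
exists (Num.min x0 b); first by rewrite lt_min x00 b0 ge_min lexx orbT.
move=> nu nuG y r /andP [rr]; rewrite le_min => /andP [rx rb].
apply: le_trans (nuG _ (borel_ball y r)) _.
apply: le_trans (ler_wpM2l G0 (m_up y rr)) _.
have -> : D = s + (D - s) by ring.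
rewrite powRDgt0 //.
have -> : G * (Cu * (r `^ s * r `^ (D - s))) = r `^ s * (G * Cu * r `^ (D - s)) by ring.
rewrite ler_wpM2l ?powR_ge0 //.
have {}x0P : r `^ (D - s) <= (2 * (G * Cu + 1))^-1 by apply: x0P; rewrite ltW.
apply: (@le_trans _ _ ((G * Cu + 1) * (2 * (G * Cu + 1))^-1)).
  by apply: ler_pM => //; rewrite ?powR_ge0 ?lerDl.
by rewrite invfM mulrCA divff ?mulr1 // gt_eqF.
Qed.

Lemma frostman_layer (E : set T) (k : nat) (mu : set T -> R) :
  mass_in m E mu -> growth mu 1 s ->
  exists mu', [/\ mass_in m E mu', growth mu' 1 s,
    forall A, borel_set A -> mu A <= mu' A &
    forall p, ball p k.+1%:R^-1 `<=` E -> exists y r,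
      [/\ 0 < r, ball y (3 * r) p & kappa * r `^ s <= mu' (ball y r)]].
Proof.
move=> mui mug; have [muP [G G0 GP] _] := mui.
(* With a quarter, a net point close to [p] keeps its closed ball of radius [sg] inside
   [ball p k.+1%:R^-1], hence inside [E], and is not filtered out. *)
pose b : R := Num.min r0 (k.+1%:R^-1 / 4).
have b0 : 0 < b by rewrite lt_min r0_gt0 divr_gt0.
have [sg /andP [sg0]] := fine_scale G0 b0.
rewrite le_min => /andP [sgr sgk] sgP.
have [xs xsP] := finite_net cpt sg0.
pose ys := [seq x <- xs | `[< [set y | mdist x y <= sg] `<=` E >]].
have [|//|//|||beta [bin bg _ bsat]] := @saturate_bumps E mu sg ys.
- by rewrite sg0.
- by move=> y r /andP [rr rsg]; apply: sgP => //; rewrite rr ltW.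
- by move=> x; rewrite mem_filter => /andP [/asboolP].
have [bP _ _] := bin.
exists (fun A => mu A + beta A); split => //.
- exact: mass_inD.
- by move=> A mA; rewrite lerDl mass_ge0.
move=> p pE; have [x xxs xp] := xsP p.
have [|y [r [rr xy sat]]] := bsat x.
  rewrite mem_filter xxs andbT; apply/asboolP => z /= xz; apply: pE.
  apply/ball_mdistP; move/ball_mdistP: xp => xp.
  have := metric_triangle p x z; rewrite (metric_sym p x).
  have : 0 < (k.+1%:R^-1 : R) by [].
  move: sgk; set ki := k.+1%:R^-1; move: ki => ki; lra.
by exists y, r; split => //; apply: xy.
Qed.

(** By contradiction: if no stage has total mass h / CF, all stages are bounded by that number [M],
    and so is kappa times the sum of r^s over any disjoint family of balls saturated at some stage.
    Enlarging a Vitali subfamily then gives a cover of [E] of cost at most [h]. *)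
Lemma frostman : exists2 CF, 0 < CF & forall (E : set T) h, open E ->
  (h%:E < hausdorff_content s E)%E ->
  exists nu, [/\ mass_in m E nu, growth nu 1 s & h <= CF * nu setT].
Proof.
have k0 := kappa_gt0; have mT : borel_set [set: T] by exact: borel_setT.
(* A point of [E] is within 3 r of the centre of a saturated ball of radius r, which meets a
   selected ball of radius r' with r <= 2 r'. Its distance to the selected centre is below r' + 4 r
   <= 9 r', and a ball of radius 9 r' has diameter at most 18 r'. *)
exists (18 `^ s / kappa); first by rewrite divr_gt0 // powR_gt0.
move=> E h oE hE; apply: contrapT => no.
have [next nextP] : exists next : nat -> (set T -> R) -> (set T -> R), forall k mu,
    mass_in m E mu -> growth mu 1 s ->
    [/\ mass_in m E (next k mu), growth (next k mu) 1 s,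
      forall A, borel_set A -> mu A <= next k mu A &
      forall p, ball p k.+1%:R^-1 `<=` E -> exists y r,
      [/\ 0 < r, ball y (3 * r) p & kappa * r `^ s <= next k mu (ball y r)]].
  have /choice [f fP] : forall p : nat * (set T -> R), exists mu',
    mass_in m E p.2 -> growth p.2 1 s ->
    [/\ mass_in m E mu', growth mu' 1 s,
      forall A, borel_set A -> p.2 A <= mu' A &
      forall q, ball q p.1.+1%:R^-1 `<=` E -> exists y r,
      [/\ 0 < r, ball y (3 * r) q & kappa * r `^ s <= mu' (ball y r)]].
    move=> p.
    have [[H1 H2]|H] := pselect (mass_in m E p.2 /\ growth p.2 1 s).
      by have [mu' muP] := frostman_layer p.1 H1 H2; exists mu'.
    by exists p.2 => H1 H2; case: H.
  by exists (fun k mu => f (k, mu)) => k mu; exact: (fP (k, mu)).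
pose mu := fix mu k := if k is k'.+1 then next k' (mu k') else fun=> 0.
have muP k : mass_in m E (mu k) /\ growth (mu k) 1 s.
  elim: k => [|k [IH1 IH2]]; last by have [] := nextP k _ IH1 IH2.
  by split; [exact: mass_in0|move=> y r rr; rewrite mul1r powR_ge0].
have muM k : mass (mu k) by have [[]] := muP k.
have muS k A : borel_set A -> mu k A <= mu k.+1 A.
  by move=> mA; have [H1 H2] := muP k; have [_ _ + _] := nextP k _ H1 H2; exact.
have mule k l A : (k <= l)%N -> borel_set A -> mu k A <= mu l A.
  move=> kl mA; elim: l kl => [|l IH]; first by rewrite leqn0 => /eqP ->.
  rewrite leq_eqVlt => /predU1P [-> //|kl].
  exact: le_trans (IH kl) (muS l A mA).
pose M := h / (18 `^ s / kappa).
have K0 : 0 < 18 `^ s / kappa by rewrite divr_gt0 // powR_gt0.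
have muT k : mu k setT <= M.
  rewrite leNgt; apply/negP => Mk; apply: no; exists (mu k).
  have [H1 H2] := muP k; split => //.
  by rewrite mulrC -ler_pdivrMr // ltW.
have M0 : 0 <= M by apply: le_trans (muT 0%N).
pose F (p : T * R) := 0 < p.2 /\ exists k, kappa * p.2 `^ s <= mu k (ball p.1 p.2).
pose meet (p q : T * R) := ball p.1 p.2 `&` ball q.1 q.2 !=set0.
have sum_le N (v : nat -> option (T * R)) :
    (forall n p, v n = Some p -> F p) ->
    (forall n k p q, (k < n < N)%N -> v n = Some p -> v k = Some q -> ~ meet p q) ->
    \sum_(n < N) (if v n is Some p then p.2 `^ s else 0) <= M / kappa.
  move=> vF vdis.
  pose P n k : bool := if v n is Some p then
    kappa * p.2 `^ s <= mu k (ball p.1 p.2) else true.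
  (* The stages increase, so saturation persists and finitely many balls share a stage at which all
     are saturated. *)
  have [k kP] : exists k, forall n, (n < N)%N -> P n k.
    apply: eventually_all_below; rewrite /P.
      move=> n; case E1 : (v n) => [p|]; last by exists 0%N.
      by have [_ [k kP]] := vF _ _ E1; exists k.
    move=> n k l kl; case: (v n) => // p /le_trans; apply; apply: mule => //.
    exact: borel_ball.
  rewrite ler_pdivlMr // mulr_suml; apply: le_trans (muT k).
  pose B n := if v n is Some p then ball p.1 p.2 else set0.
  apply: (@le_trans _ _ (\sum_(n < N) mu k (B n))).
    apply: ler_sum => n _; have := kP n (ltn_ord n); rewrite /B /P.
    by case: (v n) => [p|_]; [rewrite mulrC|rewrite mul0r (mass_set0 (muM k))].
  apply: (mass_sum_disjoint (muM k)) => //.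
    by move=> n; rewrite /B; case: (v n) => [p|]; [exact: borel_ball|exact: borel_set0].
  move=> i j ji; rewrite /B; case E1 : (v i) => [p|]; last by rewrite set0I.
  case E2 : (v j) => [q|]; last by rewrite setI0.
  by apply/eqP; apply: contrapT => /negP/set0P; apply: vdis ji E1 E2.
have [u [uF udis ucov]] : exists u : nat -> option (T * R),
    [/\ forall n i, u n = Some i -> F i,
        forall n m i j, (m < n)%N -> u n = Some i -> u m = Some j -> ~ meet i j &
        forall i, F i -> exists n j, [/\ u n = Some j, meet i j & i.2 <= 2 * j.2]].
  apply: vitali_selection.
  - by move=> p [].
  - exists ((M / kappa) `^ s^-1) => p [p0 [k kp]].
    have pM : p.2 `^ s <= M / kappa.
      rewrite ler_pdivlMr // mulrC (le_trans kp) // (le_trans _ (muT k)) //.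
      by apply: le_mass => //; exact: borel_ball.
    have s1 : 0 <= s^-1 by rewrite invr_ge0 ltW.
    have := le_powR s1 (powR_ge0 _ _) pM.
    by rewrite -powRrM divff ?gt_eqF // powRr1 // ltW.
  move=> t t0; exists (Num.truncn (M / kappa / t `^ s)).+1 => v vF.
  apply: contrapT => nmeet.
  set N := (Num.truncn _).+1 in vF nmeet.
  have tN : M / kappa < N%:R * t `^ s.
    by rewrite -ltr_pdivrMr ?powR_gt0 // truncnS_gt.
  pose v' n := if (n < N)%N then Some (v n) else None.
  have : \sum_(n < N) (if v' n is Some p then p.2 `^ s else 0) <= M / kappa.
    apply: sum_le; rewrite /v'.
    - by move=> n p; case: ifP => // nN [<-]; have [] := vF _ nN.
    - move=> n k p q /andP [kn nN]; rewrite nN (ltn_trans kn nN) => -[<-] [<-] nk.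
      by apply: nmeet; exists n, k; rewrite kn nN.
  apply/negP; rewrite -ltNge; apply: (lt_le_trans tN).
  have -> : N%:R * t `^ s = \sum_(n < N) t `^ s.
    by rewrite sumr_const card_ord mulr_natl.
  apply: ler_sum => n _; rewrite /v' ltn_ord.
  have [_ tv] := vF _ (ltn_ord n); apply: le_powR => //; exact: ltW.
have : (hausdorff_content s E <= h%:E)%E; last by rewrite leNgt hE.
apply: (content_le
  (B := fun n => if u n is Some p then ball p.1 (9 * p.2) else set0)
  (w := fun n => (if u n is Some p then p.2 `^ s else 0) * 18 `^ s)).
- move=> n; case E1 : (u n) => [p|]; [right|by left].
  by have [p0 _] := uF _ _ E1; exists p.1, (9 * p.2); split => //; rewrite mulr_gt0.
- move=> p Ep; have [e e0 eE] := (open_metricP E).1 oE p Ep.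
  have [k ke] : exists k, k.+1%:R^-1 <= e.
    exists (Num.truncn e^-1); rewrite -[leRHS]invrK lef_pV2 ?posrE ?invr_gt0 //.
    by rewrite ltW // truncnS_gt.
  have [H1 H2] := muP k; have [_ _ _ /(_ p)] := nextP k _ H1 H2.
  case; first by apply: subset_trans eE; exact: le_ball.
  move=> y [r [rr py sat]].
  have [|n [[y' r'] [un [q [/= /ball_mdistP yq /ball_mdistP y'q]] /= rr']]] := ucov (y, r).
    by split => //; exists k.+1.
  exists n => //; rewrite un /=; apply/ball_mdistP.
  move/ball_mdistP: py => py.
  have := metric_triangle y' q p; have := metric_triangle q y p.
  rewrite (metric_sym q y); lra.
- move=> n; case E1 : (u n) => [p|]; last first.
    by rewrite diam_set0 poweR_EFin powR0 ?gt_eqF // mul0r.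
  have [p0 _] := uF _ _ E1; have p9 : 0 < 9 * p.2 by rewrite mulr_gt0.
  rewrite diam_fin; last by right; exists p.1, (9 * p.2).
  rewrite poweR_EFin lee_fin -powRM ?(ltW p0) //.
  apply: le_powR; [exact: ltW|exact/fine_ge0/diam_ge0|].
  have := diam_ball_le p.1 p9; rewrite diam_fin; last by right; exists p.1, (9 * p.2).
  by rewrite lee_fin; lra.
- move=> n; rewrite -mulr_suml.
  have -> : h = M / kappa * 18 `^ s.
    rewrite /M; field; rewrite !gt_eqF // powR_gt0.
  rewrite ler_wpM2r ?powR_ge0 //; apply: sum_le => // i k p q /andP [ki _].
  exact: udis.
Qed.

End ahlfors_space.

(** * Large intersections from locally spread measures *)

Section large_intersection.
Context (R : realType) (T : pointedMetricType R).
Variables (m : set T -> R) (D Cu cl Q r0 : R).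
Hypotheses (cpt : compact [set: T]) (mP : mass m)
  (cl_gt0 : 0 < cl) (r0_gt0 : 0 < r0) (Q_ge1 : 1 <= Q) (CuE : Cu = Q * cl)
  (m_up : forall x r, 0 < r -> m (ball x r) <= Cu * r `^ D)
  (m_lo : forall x r, 0 < r <= r0 -> cl * r `^ D <= m (ball x r)).

(** Scale invariant: a mass of total 1 carried by a ball of radius [rho] has growth constant at
    least rho^(-t). [C] may depend on [U] and [t]. *)
Definition spreads (U : set T) (t : R) := exists2 C, 0 < C &
  forall x rho, 0 < rho <= r0 -> exists eta,
    [/\ mass_in m (U `&` ball x rho) eta, eta setT = 1 &
        growth eta (C / rho `^ t) t].

(** The balls of the list cut [W] into disjoint cells, each point going to the first ball containing
    it, and the mass of a cell is spread along [eta] inside the same ball. Mass moves by less than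
    [2 * rho], so only cells inside [ball y (r + 2 * rho)] matter for [ball y r]; [q] bounds the
    fraction of each, trivially or by growth. Balls missing [K] carry nothing and need no [eta]. *)
Lemma redistribute (nu : set T -> R) (K O : set T) (rho c t : R) (xs : seq T) :
  mass nu -> borel_set K -> nu (~` K) = 0 -> 0 < rho ->
  (forall x, ball x rho `&` K !=set0 -> exists eta,
    [/\ mass_in m (O `&` ball x rho) eta, eta setT = 1 & growth eta c t]) ->
  forall W, borel_set W -> (forall y, W y -> exists2 x, x \in xs & ball x rho y) ->
  exists nu', [/\ mass_in m O nu', nu' setT = nu W &
    forall y r q, 0 < r -> 0 <= q -> 1 <= q \/ c * r `^ t <= q ->
      nu' (ball y r) <= q * nu (W `&` ball y (r + 2 * rho))].
Proof.
move=> nuP mK nuK rho0 etaP; elim: xs => [|x xs IH] W mW Wcov.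
  have W0 : W = set0 by rewrite -subset0 => y /Wcov [].
  exists (fun=> 0); split; first exact: mass_in0.
    by rewrite W0 mass_set0.
  by move=> y r q rr q0 _; rewrite W0 set0I mass_set0 // mulr0.
have mb (y : T) (r : R) : borel_set (ball y r) by exact: borel_ball.
have [||nu2 [nu2in nu2T nu2g]] := IH (W `\` ball x rho).
- exact: borel_setD.
- move=> y [/Wcov [z]]; rewrite inE => /predU1P [-> //|zxs zy _].
  by exists z.
have nuW := mass_split nuP mW (mb x rho).
have mW1 : borel_set (W `&` ball x rho) by exact: borel_setI.
have mW2 : borel_set (W `\` ball x rho) by exact: borel_setD.
have [xK|/set0P xK] := eqVneq (ball x rho `&` K) set0.
  have W10 : nu (W `&` ball x rho) = 0.
    apply: (mass_disjoint_support nuP mK nuK) => //.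
    by rewrite -setIA xK setI0.
  exists nu2; split => //; first by rewrite nuW W10 add0r.
  move=> y r q rr q0 qP; apply: le_trans (nu2g y r q rr q0 qP) _.
  rewrite ler_wpM2l //; apply: le_mass => //; [exact: borel_setI..|].
  by apply: setSI; exact: subDsetl.
have [eta [etain etaT etag]] := etaP x xK.
have [etaM _ [J [cJ JO J0]]] := etain.
exists (fun A => nu (W `&` ball x rho) * eta A + nu2 A); split.
- apply: mass_inD => //; apply: mass_inZ => //; first exact: mass_ge0.
  by apply: mass_inS etain; exact: subIsetl.
- by rewrite etaT mulr1 nu2T -nuW.
move=> y r q rr q0 qP.
rewrite (mass_split nuP (borel_setI mW (mb y (r + 2 * rho))) (mb x rho)) mulrDr.
apply: lerD; last first.
  apply: le_trans (nu2g y r q rr q0 qP) _.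
  rewrite (_ : (W `\` _) `&` _ = (W `&` ball y (r + 2 * rho)) `\` ball x rho) //.
  by rewrite !setDE setIAC.
have [yx|/set0P [p [/ball_mdistP yp /ball_mdistP xp]]] :=
  eqVneq (ball y r `&` ball x rho) set0.
  rewrite (mass_disjoint_support etaM (borel_closed cJ) J0 (mb y r)); last first.
    rewrite -subset0 => p [yp /JO [_ xp]].
    by have : (ball y r `&` ball x rho) p by []; rewrite yx.
  rewrite mulr0 mulr_ge0 // mass_ge0 //; apply: borel_setI => //.
  exact: borel_setI.
have -> : W `&` ball y (r + 2 * rho) `&` ball x rho = W `&` ball x rho.
  rewrite setIAC; apply: setIidl => z [_]; apply: ball_sub.
  by have := metric_triangle y p x; rewrite (metric_sym p x); lra.
rewrite mulrC ler_wpM2r //; first exact: mass_ge0.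
case: qP => [q1|]; last exact: le_trans (etag y r rr).
apply: le_trans q1; rewrite -etaT; apply: le_mass => //; exact: borel_setT.
Qed.

(** Well above the scale [rho] the displacement of mass is a negligible change of radius; up to a
    multiple of [rho] the old mass of a ball is of order rho^D, and rho^(D - t) absorbs [C] together
    with the density bound. *)
Lemma spread_step (nu : set T -> R) (V U : set T) (A A' t : R) :
  0 < t < D -> 0 < A < A' -> open V -> spreads U t ->
  mass_in m V nu -> growth nu A t ->
  exists nu', [/\ mass_in m (V `&` U) nu', nu' setT = nu setT & growth nu' A' t].
Proof.
move=> /andP [t0 tD] /andP [A0 AA'] oV [C C0 UC] nuin nug.
have [nuM [G G0 nuG] [K [cK KV nuK]]] := nuin.
have [e e0 eP] := closed_in_open_gap cpt cK oV KV.
have A'0 : 0 < A' by exact: lt_trans AA'.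
(* Dilating radii by [1 + q0] turns the growth constant [A] into [A']. *)
pose q0 := (A' / A) `^ t^-1 - 1.
have q0P : (1 + q0) `^ t = A' / A.
  by rewrite /q0 addrC subrK -powRrM mulVf ?gt_eqF // powRr1 // divr_ge0 // ltW.
have q00 : 0 < q0.
  rewrite subr_gt0 ltNge; apply/negP => h.
  have := le_powR (ltW t0) (powR_ge0 _ _) h.
  rewrite powR1 -powRrM mulVf ?gt_eqF // powRr1 ?divr_ge0 ?(ltW A0) ?(ltW A'0) //.
  by rewrite ler_pdivrMr // mul1r leNgt AA'.
(* For [r >= L * rho] the displacement [2 * rho] is at most [q0 * r]; for smaller [r] the enlarged
   ball has radius at most [(L + 2) * rho] and the density bound, collected in [B], takes over. *)
pose L := 2 / q0; have L0 : 0 < L by rewrite divr_gt0.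
pose B := C * G * Cu * (L + 2) `^ D.
have Cu0 : 0 < Cu by rewrite CuE mulr_gt0 // (lt_le_trans _ Q_ge1).
have B0 : 0 <= B by rewrite !mulr_ge0 ?powR_ge0 // ltW.
have [||x0 x00 x0P] := @powR_small R (D - t) (A' / (B + 1)).
- by rewrite subr_gt0.
- by rewrite divr_gt0 // ltr_wpDl.
(* [x0] beats [B], [r0] is the range where [U] spreads, and [e / 2] keeps every ball of radius [rho]
   that meets [K] inside [V]. *)
pose rho := Num.min x0 (Num.min r0 (e / 2)).
have rho0 : 0 < rho by rewrite !lt_min x00 r0_gt0 divr_gt0.
have [rhox rhor rhoe] : [/\ rho <= x0, rho <= r0 & rho <= e / 2].
  by split; rewrite !ge_min lexx ?orbT.
have [xs xsP] := finite_net cpt rho0.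
have etaP x : ball x rho `&` K !=set0 -> exists eta,
    [/\ mass_in m (V `&` U `&` ball x rho) eta, eta setT = 1 &
        growth eta (C / rho `^ t) t].
  move=> [p [xp Kp]]; have [|eta [etain etaT etag]] := UC x rho.
    by rewrite rho0.
  exists eta; split => //; apply: mass_inS etain => y [Uy xy]; do !split => //.
  apply: eP Kp _ _; apply/ball_mdistP.
  move/ball_mdistP: xp => xp; move/ball_mdistP: xy => xy.
  by have := metric_triangle p x y; rewrite (metric_sym p x); lra.
have mT : borel_set [set: T] by exact: borel_setT.
have [nu' [nu'in nu'T nu'g]] := redistribute nuM (borel_closed cK) nuK rho0 etaP
  mT (fun y _ => xsP y).
exists nu'; split => // y r rr.
have [Lr|rL] := leP (L * rho) r.
  apply: le_trans (nu'g y r 1 rr ler01 (or_introl (lexx _))) _.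
  have rrho : 2 * rho <= q0 * r.
    have -> : 2 * rho = q0 * (L * rho) by rewrite /L; field; rewrite gt_eqF.
    by rewrite ler_wpM2l // ltW.
  rewrite mul1r setTI; apply: (@le_trans _ _ (nu (ball y ((1 + q0) * r)))).
    apply: le_mass => //; [exact: borel_ball..|]; apply: le_ball; lra.
  apply: le_trans (nug _ _ _) _; first by rewrite mulr_gt0 // addr_gt0.
  have q1 : 0 <= 1 + q0 by rewrite addr_ge0 // ltW.
  rewrite (powRM _ q1 (ltW rr)) q0P.
  by rewrite mulrA [A * _]mulrC divfK // gt_eqF.
pose q := C / rho `^ t * r `^ t.
have q_ge0 : 0 <= q by rewrite mulr_ge0 ?powR_ge0 // divr_ge0 ?powR_ge0 // ltW.
apply: le_trans (nu'g y r q rr q_ge0 (or_intror (lexx _))) _.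
have b1 : nu (setT `&` ball y (r + 2 * rho)) <= G * (Cu * ((L + 2) * rho) `^ D).
  rewrite setTI; apply: (@le_trans _ _ (nu (ball y ((L + 2) * rho)))).
    apply: le_mass => //; [exact: borel_ball..|]; apply: le_ball; lra.
  apply: le_trans (nuG _ (borel_ball _ _)) _.
  by rewrite ler_wpM2l // m_up // mulr_gt0 // addr_gt0.
apply: le_trans (ler_wpM2l q_ge0 b1) _.
have -> : q * (G * (Cu * ((L + 2) * rho) `^ D)) = B * rho `^ (D - t) * r `^ t.
  rewrite powRM ?addr_ge0 ?(ltW L0) ?(ltW rho0) //.
  have -> : rho `^ D = rho `^ t * rho `^ (D - t) by rewrite -powRDgt0 // addrC subrK.
  by rewrite /q /B; field; rewrite gt_eqF // powR_gt0.
rewrite ler_wpM2r ?powR_ge0 //.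
have {}x0P : rho `^ (D - t) <= A' / (B + 1) by apply: x0P; rewrite ltW.
apply: (@le_trans _ _ ((B + 1) * (A' / (B + 1)))).
  by apply: ler_pM => //; rewrite ?powR_ge0 ?lerDl.
by rewrite mulrCA divff ?mulr1 // gt_eqF // ltr_wpDl.
Qed.

Lemma open_shrink (K O : set T) : closed K -> open O -> K `<=` O ->
  exists V, [/\ open V, K `<=` V & closure V `<=` O].
Proof.
move=> cK oO KO; have [e e0 eP] := closed_in_open_gap cpt cK oO KO.
exists (\bigcup_(x in K) ball x (e / 2)); split.
- by apply: bigcup_open => x _; exact: open_ball_metric.
- by move=> x Kx; exists x => //; apply: ballxx; rewrite divr_gt0.
move=> y /(_ (ball y (e / 2))) [|z [[x Kx /ball_mdistP xz] /ball_mdistP yz]].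
  by apply: nbhsx_ballx; rewrite divr_gt0.
apply: (eP x Kx); apply/ball_mdistP.
by have := metric_triangle x z y; rewrite (metric_sym z y); lra.
Qed.

(** Content is priced by diameters, growth by radii. A ball lies in every concentric ball of radius
    larger than its diameter d, though not necessarily in that of radius d; were the bound to fail,
    a radius halfway between d and the [w] with A w^t = nu(B) would contradict growth. *)
Lemma growth_empty_or_ball (nu : set T -> R) (A t : R) (B : set T) :
  0 < t -> 0 < A -> mass nu -> growth nu A t -> empty_or_ball B ->
  nu B <= A * fine (diam B) `^ t.
Proof.
move=> t0 A0 nuM nug bB; have := diam_fin bB; set d := fine _ => dE.
have d0 : 0 <= d by rewrite -lee_fin -dE diam_ge0.
case: bB => [->|[x [r [rr BE]]]].
  by rewrite mass_set0 // mulr_ge0 ?powR_ge0 // ltW.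
have nuB0 : 0 <= nu B by rewrite BE mass_ge0 //; exact: borel_ball.
rewrite leNgt; apply/negP => h.
pose w := (nu B / A) `^ t^-1.
have wt : w `^ t = nu B / A.
  by rewrite -powRrM mulVf ?gt_eqF // powRr1 // divr_ge0 // ltW.
have dw : d < w.
  rewrite ltNge; apply/negP => /(le_powR (ltW t0) (powR_ge0 _ _)).
  by rewrite wt ler_pdivrMr // mulrC leNgt h.
have dw0 : 0 < (d + w) / 2 by lra.
have : nu B <= nu (ball x ((d + w) / 2)).
  rewrite {1}BE; apply: le_mass => //; [exact: borel_ball..|].
  move=> y xy; apply/ball_mdistP; apply: (@le_lt_trans _ _ d); last by lra.
  by rewrite -lee_fin -dE BE; apply: mdist_le_diam => //; apply: ballxx.
apply/negP; rewrite -ltNge; apply: le_lt_trans (nug _ _ dw0) _.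
have -> : nu B = A * w `^ t by rewrite wt mulrC divfK // gt_eqF.
rewrite ltr_pM2l //; apply: gt0_ltr_powR => //; rewrite ?nnegrE ?ltW //; lra.
Qed.

Lemma content_bigcap_ge (U : nat -> set T) (V : set T) (nu : set T -> R) (A t : R) :
  0 < t < D -> 0 < A -> (forall n, open (U n)) -> (forall n, spreads (U n) t) ->
  open V -> mass_in m V nu -> growth nu A t ->
  ((nu setT / (2 * A))%:E <= hausdorff_content t (\bigcap_n U n `&` V))%E.
Proof.
move=> tD A0 oU sU oV nuin nug; have t0 : 0 < t by case/andP: tD.
(* Strictly increasing from [A] and below [2 * A]: each step may lose a factor above 1, all steps
   together less than 2. *)
pose a k : R := A * (2 - 2^-1 ^+ k).
pose state k (p : (set T -> R) * set T) :=
  [/\ open p.2, mass_in m p.2 p.1, p.1 setT = nu setT & growth p.1 (a k) t].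
have p2 k : 0 < (2^-1 ^+ k : R) <= 1.
  by rewrite exprn_gt0 ?invr_gt0 //= exprn_ile1 ?invr_ge0 // invf_le1 // ler1n.
have a_gt0 k : 0 < a k by rewrite mulr_gt0 //; have := p2 k; lra.
have a_le k : a k <= 2 * A.
  by rewrite mulrC ler_wpM2l ?ltW //; have := p2 k; lra.
have step (kp : nat * ((set T -> R) * set T)) : exists p', state kp.1 kp.2 ->
    state kp.1.+1 p' /\ closure p'.2 `<=` kp.2.2 `&` U kp.1.
  case: kp => k p /=; have [[op pin pT pg]|ns] := pselect (state k p); last by exists p.
  have aa : 0 < a k < a k.+1.
    by rewrite a_gt0 /= ltr_pM2l // exprS; have := p2 k; lra.
  have [nu' [nu'in nu'T nu'g]] := spread_step tD aa op (sU k) pin pg.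
  have [_ _ [K [cK KVU K0]]] := nu'in.
  have [V' [oV' KV' V'O]] := open_shrink cK (openI op (oU k)) KVU.
  exists (nu', V') => _; split => //; split => //=; last by rewrite nu'T.
  by have [H1 H2 _] := nu'in; split => //; exists K.
have [f fP] := choice step.
pose p := fix p k := if k is k'.+1 then f (k', p k') else (nu, V).
have pP k : state k (p k).
  elim: k => [|k IH]; last by have [] := fP (k, p k) IH.
  by split => //; rewrite /a expr0 (_ : _ - _ = 1) ?mulr1 //; lra.
have pS k : closure (p k.+1).2 `<=` (p k).2 `&` U k.
  by have [] := fP (k, p k) (pP k).
apply: content_ge => B Bb UB.
have Bo k : open (B k).
  by case: (Bb k) => [->|[x [r [_ ->]]]]; [exact: open0|exact: open_ball_metric].
have [||||n nB] := @compact_nested_cover R T cpt (fun k => closure (p k.+1).2) B.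
- by move=> n; exact: closed_closure.
- move=> n k; elim: k => [|k IH]; first by rewrite leqn0 => /eqP ->.
  rewrite leq_eqVlt => /predU1P [-> //|nk]; apply: subset_trans (IH nk).
  by move=> x /pS [+ _]; exact: subset_closure.
- exact: Bo.
- move=> x xC; apply: UB; split; last by have [] := pS 0%N x (xC 0%N I).
  by move=> k _; have [] := pS k x (xC k I).
(* The mass of this single stage is carried by the first [n] members of the cover and still has the
   original total. *)
exists n; have [_ [M _ [K [cK KV K0]]] MT Mg] := pP n.+1.
have mB k : borel_set (B k) by exact: borel_open.
have [mU Ule] := mass_bigcup_le M n mB.
rewrite ler_pdivrMr ?mulr_gt0 // -MT.
have mT : borel_set [set: T] by exact: borel_setT.
rewrite (mass_split M mT mU).
have -> : (p n.+1).1 ([set: T] `\` \bigcup_(i < n) B i) = 0.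
  apply: (mass_disjoint_support M (borel_closed cK) K0); first exact: borel_setD.
  rewrite -subset0 => x [[_ nUx] /KV Vx]; apply: nUx; apply: nB.
  exact: subset_closure.
rewrite addr0 setTI; apply: le_trans Ule _; rewrite mulr_suml.
apply: ler_sum => i _; apply: le_trans (growth_empty_or_ball t0 (a_gt0 n.+1) M Mg (Bb i)) _.
by rewrite mulrC ler_wpM2l ?powR_ge0.
Qed.

Lemma bump_growth x sg t : 0 < sg <= r0 -> 0 <= t <= D ->
  growth (bump m x sg) (Q / sg `^ t) t.
Proof.
move=> sg0 /andP [t0 tD] y r rr; have s0 : 0 < sg by case/andP: sg0.
have Q0 : 0 < Q by exact: lt_le_trans Q_ge1.
have -> : Q / sg `^ t * r `^ t = Q * (r / sg) `^ t.
  by rewrite powR_div ?(ltW rr) //; ring.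
have [sr|rs] := leP sg r.
  apply: (@le_trans _ _ 1).
    apply: bump_le1 => //; [exact: borel_ball|].
    exact: (m_ball_gt0 cl_gt0 m_lo).
  rewrite -[leLHS]mulr1; apply: ler_pM => //.
  have : 1 `^ t <= (r / sg) `^ t by apply: le_powR => //; rewrite ler_pdivlMr // mul1r.
  by rewrite powR1.
apply: le_trans (bump_ball_le mP cl_gt0 Q_ge1 CuE m_up m_lo x y sg0 rr) _.
rewrite ler_wpM2l ?(ltW Q0) //; apply: ger_powR => //.
by rewrite divr_gt0 //= ler_pdivrMr // mul1r ltW.
Qed.

Lemma bounded_metric : exists2 L : R, 0 < L & forall x y : T, mdist x y <= L.
Proof.
have [||||n nP] := @compact_nested_cover R T cpt (fun=> setT) (fun n => ball point n%:R).
- by move=> _; exact: closedT.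
- by [].
- by move=> n; exact: open_ball_metric.
- move=> x _; exists (Num.truncn (mdist point x)).+1 => //.
  by apply/ball_mdistP; exact: truncnS_gt.
have nP' (x : T) : mdist point x <= n%:R.
  have [i /= i_n /ball_mdistP /ltW xi] := nP x I.
  by apply: le_trans xi _; rewrite ler_nat ltnW.
exists (n%:R + n%:R + 1); first by rewrite ltr_wpDl // addr_ge0.
move=> x y; have := metric_triangle x point y; rewrite (metric_sym x point).
by have := nP' x; have := nP' y; lra.
Qed.

Lemma large_intersection_bigcap (U : nat -> set T) (s : R) :
  0 < s <= D -> (forall n, open (U n)) ->
  (forall n t, 0 < t < s -> spreads (U n) t) ->
  large_intersection_class s (\bigcap_n U n).
Proof.
move=> /andP [s0 sD] oU sU; split; first by exists U.
have [L L0 LP] := bounded_metric.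
have Q0 : 0 < Q by exact: lt_le_trans Q_ge1.
(* A ball of radius [r] has diameter at most [b * Num.min r r0]: the 2 serves small balls, [L / r0]
   those larger than [r0]. *)
pose b := Num.max 2 (L / r0).
have b2 : 2 <= b by rewrite le_max lexx.
have bL : L / r0 <= b by rewrite le_max lexx orbT.
have b0 : 0 < b by lra.
(* The starting bump of radius r1 / 2 yields content at least r1^t / (2 Q 2^t), against at most b^t
   r1^t for the ball. Replacing b^t and 2^t by their s-th powers removes t; 4 instead of 2 makes the
   inequality strict. *)
exists (4 * Q * b `^ s * 2 `^ s)^-1; first by rewrite invr_gt0 !mulr_gt0 ?powR_gt0.
move=> t /andP [t0 ts] B [x [r [rr ->]]].
pose r1 := Num.min r r0; have r10 : 0 < r1 by rewrite lt_min rr r0_gt0.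
pose sg := r1 / 2; have sg0 : 0 < sg by rewrite divr_gt0.
have sgr : 0 < sg <= r0.
  rewrite sg0 /= /sg; have : r1 <= r0 by rewrite ge_min lexx orbT.
  lra.
have tD : 0 <= t <= D by rewrite ltW //= (le_trans (ltW ts)).
have bumpin : mass_in m (ball x r) (bump m x sg).
  apply: bump_in => //; first exact: (m_ball_gt0 cl_gt0 m_lo).
  move=> y /= xy; apply/ball_mdistP; apply: le_lt_trans xy _.
  have : r1 <= r by rewrite ge_min lexx.
  rewrite /sg; lra.
have A0 : 0 < Q / sg `^ t by rewrite divr_gt0 // powR_gt0.
have tD' : 0 < t < D by rewrite t0 (lt_le_trans ts).
have sUt n : spreads (U n) t by apply: sU; rewrite t0.
have := content_bigcap_ge tD' A0 oU sUt (open_ball_metric x r) bumpin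
  (bump_growth x sgr tD).
have mb0 : 0 < m (ball x sg) by exact: (m_ball_gt0 cl_gt0 m_lo).
rewrite bump_full //.
apply: lt_le_trans.
set d := fine (diam (ball x r)).
have bb : empty_or_ball (ball x r) by right; exists x, r.
have d0 : 0 <= d by exact/fine_ge0/diam_ge0.
have dr1 : d <= b * r1.
  have dle M : 0 <= M -> (forall y z, ball x r y -> ball x r z -> mdist y z <= M) -> d <= M.
    by move=> M0 h; rewrite -lee_fin -(diam_fin bb); exact: diam_le.
  rewrite /r1; have [rle|rlt] := leP r r0.
    apply: (@le_trans _ _ (2 * r)); last by rewrite ler_pM2r.
    by rewrite -lee_fin -(diam_fin bb); exact: diam_ball_le.
  apply: dle; first by rewrite mulr_ge0 // ltW.
  move=> y z _ _; apply: le_trans (LP y z) _.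
  by rewrite -ler_pdivrMr.
pose c := (4 * Q * b `^ s * 2 `^ s)^-1.
have c0 : 0 < c by rewrite invr_gt0 !mulr_gt0 ?powR_gt0.
apply: (@le_lt_trans _ _ (c * (b `^ s * r1 `^ t))%:E).
  rewrite EFinM lee_wpmul2l ?lee_fin ?(ltW c0) //.
  apply: le_trans (content_ball_le x t0 rr) _; rewrite lee_fin.
  apply: (@le_trans _ _ ((b * r1) `^ t)); first by apply: le_powR => //; exact: ltW.
  rewrite powRM ?(ltW b0) ?(ltW r10) // ler_wpM2r ?powR_ge0 //.
  apply: ler_powR; [lra|exact: ltW].
have r1t : 0 < r1 `^ t by exact: powR_gt0.
have sgE : sg `^ t = r1 `^ t / 2 `^ t.
  by rewrite powR_div // ltW.
have h2 : (2 : R) `^ t <= 2 `^ s by apply: ler_powR; [lra|exact: ltW].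
have t2 : 0 < (2 : R) `^ t by exact: powR_gt0.
have s2 : 0 < (2 : R) `^ s by exact: powR_gt0.
have bs : 0 < b `^ s by exact: powR_gt0.
rewrite lte_fin sgE.
have -> : c * (b `^ s * r1 `^ t) = r1 `^ t / (4 * Q) * (2 `^ s)^-1.
  by rewrite /c; field; rewrite !gt_eqF.
have -> : 1 / (2 * (Q / (r1 `^ t / 2 `^ t))) = r1 `^ t / (2 * Q) * (2 `^ t)^-1.
  by field; rewrite !gt_eqF.
apply: (@lt_le_trans _ _ (r1 `^ t / (2 * Q) * (2 `^ s)^-1)).
  rewrite ltr_pM2r ?invr_gt0 // ltr_pM2l // ltf_pV2 ?posrE ?mulr_gt0 //.
  by rewrite ltr_pM2r //; lra.
rewrite ler_wpM2l ?lef_pV2 ?posrE // divr_ge0 ?ltW // mulr_gt0 //.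
Qed.

End large_intersection.

(** * Products of Ahlfors regular spaces *)

Section finite_measure.
Context (R : realType) (T : pointedMetricType R).
Variable mu : {measure set (borel T) -> \bar R}.
Hypothesis muT : (mu [set: T] < +oo)%E.

Lemma fine_measureK A : borel_set A -> (fine (mu A))%:E = mu A.
Proof.
move=> mA; rewrite fineK // ge0_fin_numE ?measure_ge0 //.
by apply: le_lt_trans muT; apply: le_measure; rewrite ?inE.
Qed.

Lemma fine_measure_mass : mass (fun A => fine (mu A)).
Proof.
split=> [A mA|A B mA mB AB]; first exact/fine_ge0/measure_ge0.
apply: EFin_inj; rewrite EFinD !fine_measureK //; last exact: borel_setU.
by rewrite measureU.
Qed.

End finite_measure.

Lemma ahlfors_bounds (R : realType) (T : pointedMetricType R)
    (mu : {measure set (borel T) -> \bar R}) (delta : R) :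
  compact [set: T] -> ahlfors_regular mu delta ->
  [/\ 0 <= delta, (mu [set: T] < +oo)%E &
   exists c C r0 : R, [/\ 0 < c, 0 < C, 0 < r0,
     forall x r, 0 < r -> fine (mu (ball x r)) <= C * r `^ delta &
     forall x r, 0 < r <= r0 -> c * r `^ delta <= fine (mu (ball x r))]].
Proof.
move=> cpt [C [r0 [C0 r00 muP]]].
have muT : (mu [set: T] < +oo)%E.
  have [xs xsP] := finite_net cpt r00.
  have : forall ys : seq T, exists2 U, borel_set U /\ (mu U < +oo)%E &
      forall y, (exists2 x, x \in ys & ball x r0 y) -> U y.
    elim=> [|x ys [U [mU Uoo] UP]].
      by exists set0; [split; [exact: borel_set0|rewrite measure0 ltry]|move=> y []].
    have mb : borel_set (ball x r0) by exact: borel_ball.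
    exists (ball x r0 `|` U).
      split; first exact: borel_setU.
      apply: le_lt_trans (measureU2 _ _ _) _ => //; apply: lte_add_pinfty => //.
      have rr : 0 < r0 <= r0 by rewrite r00 lexx.
      have /andP [_ h] := muP x r0 rr; exact: le_lt_trans h (ltry _).
    move=> y [z]; rewrite inE => /predU1P [-> zy|zys zy]; [by left|right].
    by apply: UP; exists z.
  move=> /(_ xs) [U [mU Uoo] UP]; apply: le_lt_trans Uoo.
  apply: le_measure; rewrite ?inE //.
  by move=> y _; apply: UP; have [x xxs xy] := xsP y; exists x.
have bE x r : mu (ball x r) = (fine (mu (ball x r)))%:E.
  by rewrite fine_measureK //; exact: borel_ball.
have lo x r : 0 < r <= r0 -> C^-1 * r `^ delta <= fine (mu (ball x r)).
  by move=> rr; have /andP [+ _] := muP x r rr; rewrite bE lee_fin.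
have up x r : 0 < r <= r0 -> fine (mu (ball x r)) <= C * r `^ delta.
  by move=> rr; have /andP [_] := muP x r rr; rewrite bE lee_fin.
have mP := fine_measure_mass muT.
have d0 : 0 <= delta.
  rewrite leNgt; apply/negP => dlt.
  (* For a negative exponent the lower bound blows up at small radii, while each small ball sits in
     one of radius [r0]. [w] exceeds the value of r^delta allowed by this inclusion. *)
  pose w := C * (C * r0 `^ delta) + 1.
  have w0 : 0 < w by rewrite ltr_wpDl // !mulr_ge0 ?powR_ge0 // ltW.
  have [||x0 x00 x0P] := @powR_small R (- delta) w^-1.
  - by rewrite oppr_gt0.
  - by rewrite invr_gt0.
  pose r := Num.min x0 r0; have rr : 0 < r by rewrite lt_min x00.
  have rr0 : r <= r0 by rewrite ge_min lexx orbT.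
  have h1 : C^-1 * r `^ delta <= C * r0 `^ delta.
    apply: le_trans (lo point r _) _; first by rewrite rr.
    apply: le_trans (up point r0 _); last by rewrite r00 lexx.
    by apply: (le_mass mP); [exact: borel_ball..|exact: le_ball].
  have : r `^ (- delta) <= w^-1 by apply: x0P; rewrite ltW //= ge_min lexx.
  rewrite powRN lef_pV2 ?posrE ?powR_gt0 //.
  rewrite ler_pdivrMl // in h1; rewrite /w; lra.
split => //; pose M := fine (mu setT).
have M0 : 0 <= M by exact/fine_ge0/measure_ge0.
(* Beyond [r0] the total mass [M] is at most M / r0^delta times r^delta, since [delta] is
   nonnegative. *)
exists C^-1, (C + M / r0 `^ delta), r0; split => //.
- by rewrite invr_gt0.
- by rewrite ltr_pwDl // divr_ge0 // powR_ge0.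
move=> x r rr; rewrite mulrDl; have [rle|rlt] := leP r r0.
  apply: le_trans (up x r _) _; first by rewrite rr.
  by rewrite lerDl mulr_ge0 ?powR_ge0 // divr_ge0 // powR_ge0.
apply: (@le_trans _ _ M).
  by apply: (le_mass mP); [exact: borel_ball|exact: borel_setT|].
rewrite ler_wpDl ?mulr_ge0 ?powR_ge0 ?(ltW C0) // mulrAC ler_pdivlMr ?powR_gt0 //.
by rewrite ler_wpM2l //; apply: le_powR => //; exact: ltW.
Qed.

Section maxprod_facts.
Context (R : realType) (d : nat) (X : 'I_d.+1 -> pointedMetricType R).
Implicit Types (x y z : maxprod X) (r : R).

Lemma maxprod_mdist_ltP x y r : 0 < r ->
  mdist x y < r <-> forall i, mdist (x i) (y i) < r.
Proof.
move=> r0; split=> [xy i|xy]; first exact: le_lt_trans (mdist_le_maxdist x y i) xy.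
by apply/bigmax_ltP; split.
Qed.

Definition rect z (rho : 'I_d.+1 -> R) : set (maxprod X) :=
  box (fun i => ball (z i) (rho i)).

Lemma rectP z rho y : rect z rho y <-> forall i, mdist (z i) (y i) < rho i.
Proof. by split=> h i; apply/ball_mdistP; exact: h. Qed.

Lemma ball_rect x r : 0 < r -> ball x r = rect x (fun=> r).
Proof.
move=> r0; apply/seteqP; split=> y.
  by move=> /ball_mdistP /(maxprod_mdist_ltP x y r0) h; apply/rectP.
by move=> /rectP h; apply/ball_mdistP/(maxprod_mdist_ltP x y r0).
Qed.

Lemma open_rect z rho : open (rect z rho).
Proof.
apply/open_metricP => y /rectP h.
pose e := \big[Num.min/1]_i (rho i - mdist (z i) (y i)).
have e0 : 0 < e by apply/bigmin_gtP; split => // i _; rewrite subr_gt0.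
exists e => // w; rewrite ball_rect // => /rectP yw; apply/rectP => i.
have : e <= rho i - mdist (z i) (y i) by exact: bigmin_le_cond.
have := yw i; have := metric_triangle (z i) (y i) (w i); lra.
Qed.

(** Tychonoff applies to the product topology. With finitely many factors a ball of the maximum
    metric is a finite intersection of coordinate conditions, so the identity onto [maxprod X] is
    continuous and carries compactness over. *)
Lemma compact_maxprod : (forall i, compact [set: X i]) -> compact [set: maxprod X].
Proof.
move=> cX; have := tychonoff cX.
rewrite (_ : [set f | _] = [set: prod_topology X]); last by apply/seteqP; split.
move=> cpt; pose f : prod_topology X -> maxprod X := id.
have cf : continuous f.
  move=> x A /nbhs_ballP [e /= e0 eA].
  have : nbhs x (fun y : prod_topology X => forall i, ball (x i) e (y i)).
    apply: (@filter_forall _ _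
      (fun i => [set y : prod_topology X | ball (x i) e (y i)]) (nbhs x)) => i.
    by apply: (@proj_continuous _ X i x); exact: nbhsx_ballx.
  apply: filterS => y xy; apply: eA; apply/ball_mdistP.
  by apply/(maxprod_mdist_ltP (f x) (f y) e0) => i; apply/ball_mdistP; exact: xy.
have := continuous_compact (continuous_subspaceT cf) cpt.
by rewrite (_ : [set f x | x in _] = setT) //; apply/seteqP; split => // x _; exists x.
Qed.

Lemma rect_measure_bounds (delta : 'I_d.+1 -> R)
    (m : forall i, {measure set (borel (X i)) -> \bar R})
    (mx : {measure set (borel (maxprod X)) -> \bar R}) :
  (forall i, compact [set: X i]) ->
  (forall i, ahlfors_regular (m i) (delta i)) -> is_product_measure m mx ->
  [/\ forall i, 0 <= delta i, (mx [set: maxprod X] < +oo)%E &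
   exists c C r0 : R, [/\ 0 < c, 0 < C, 0 < r0,
     forall z rho, (forall i, 0 < rho i) ->
       fine (mx (rect z rho)) <= C * \prod_i rho i `^ delta i &
     forall z rho, (forall i, 0 < rho i <= r0) ->
       c * \prod_i rho i `^ delta i <= fine (mx (rect z rho))]].
Proof.
move=> cX mreg mxP.
have bd i := ahlfors_bounds (cX i) (mreg i).
have boxE (A : forall i, set (X i)) : (forall i, borel_set (A i)) ->
    mx (box A) = (\prod_i fine (m i (A i)))%:E.
  move=> mA; rewrite mxP //.
  have -> : (\prod_(i < d.+1) m i (A i) = \prod_(i < d.+1) (fine (m i (A i)))%:E)%E.
    by apply: eq_bigr => i _; rewrite fine_measureK //; have [] := bd i.
  by rewrite prodEFin.
have ex i : exists p : R * R * R, [/\ 0 < p.1.1, 0 < p.1.2, 0 < p.2,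
     forall (x : X i) r, 0 < r -> fine (m i (ball x r)) <= p.1.2 * r `^ delta i &
     forall (x : X i) r, 0 < r <= p.2 -> p.1.1 * r `^ delta i <= fine (m i (ball x r))].
  by have [_ _ [c [C [r0 P]]]] := bd i; exists (c, C, r0).
have [f fP] := choice ex.
split; first by move=> i; have [] := bd i.
  rewrite (_ : setT = box (fun i => [set: X i])) ?boxE ?ltry //.
    by move=> i; exact: borel_setT.
  by apply/seteqP; split.
have rectE z rho : fine (mx (rect z rho)) = \prod_i fine (m i (ball (z i) (rho i))).
  by rewrite boxE // => i; exact: borel_ball.
exists (\prod_i (f i).1.1), (\prod_i (f i).1.2), (\big[Num.min/1]_i (f i).2); split.
- by apply: prodr_gt0 => i _; have [] := fP i.
- by apply: prodr_gt0 => i _; have [] := fP i.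
- by apply/bigmin_gtP; split => // i _; have [] := fP i.
- move=> z rho rho0; rewrite rectE -big_split /=; apply: ler_prod => i _.
  by have [_ _ _ h _] := fP i; rewrite h // andbT; exact/fine_ge0/measure_ge0.
- move=> z rho rho0; rewrite rectE -big_split /=; apply: ler_prod => i _.
  have [h1 _ _ _ h] := fP i; rewrite mulr_ge0 ?powR_ge0 ?(ltW h1) //=.
  apply: h; have /andP [-> h2] := rho0 i; apply: le_trans h2 _.
  exact: bigmin_le_cond.
Qed.

End maxprod_facts.

Lemma powR_sum (R : realType) (x : R) n (f : 'I_n -> R) : 0 < x ->
  \prod_i x `^ f i = x `^ (\sum_i f i).
Proof.
by move=> x0; elim/big_ind2: _ => [|p u q v -> ->|//]; rewrite ?powRr0 ?powRDgt0.
Qed.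

Section content_exponents.
Context (R : realType) (T : pointedMetricType R).
Implicit Types (A : set T) (r s t : R).

Lemma content_le_diam s A r : 0 < s -> 0 < r -> (diam A <= r%:E)%E ->
  (hausdorff_content s A <= ((4 * r) `^ s)%:E)%E.
Proof.
move=> s0 r0 Ar; have r20 : 0 < 2 * r by rewrite mulr_gt0.
(* Radius [2 * r] rather than [r]: balls are open and two points of [A] may be at distance exactly
   [r]. *)
have [x Ax] : exists x, A `<=` ball x (2 * r).
  have [->|/set0P [x Ax]] := eqVneq A set0; first by exists point.
  exists x => y Ay; apply/ball_mdistP.
  have : mdist x y <= r by rewrite -lee_fin (le_trans _ Ar) //; exact: mdist_le_diam.
  lra.
apply: le_trans (le_content s Ax) _; apply: le_trans (content_ball_le _ _ _) _ => //.
rewrite lee_fin; apply: le_powR; [exact: ltW|exact/fine_ge0/diam_ge0|].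
have bb : empty_or_ball (ball x (2 * r)) by right; exists x, (2 * r).
rewrite -lee_fin -(diam_fin bb) (le_trans (diam_ball_le x r20)) // lee_fin; lra.
Qed.

(** A cover with a member of diameter above 1 already costs at least 1; otherwise lowering the
    exponent only raises the cost of each member. *)
Lemma content_exponent_lt s t A h : 0 < t -> t <= s -> h < 1 ->
  (h%:E < hausdorff_content s A)%E -> (h%:E < hausdorff_content t A)%E.
Proof.
move=> t0 ts h1 hs.
have : (mine 1%E (hausdorff_content s A) <= hausdorff_content t A)%E.
  apply: le_ereal_inf_tmp => _ [B [Bb AB] <-].
  have [[k k1]|small] := pselect (exists k, (1 < diam (B k))%E).
    rewrite ge_min; apply/orP; left.
    apply: le_trans (nneseries_lim_ge k.+1 _); last by move=> *; exact: poweR_ge0.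
    rewrite big_mkord big_ord_recr /=; apply: lee_paddl.
      by apply: sume_ge0 => *; exact: poweR_ge0.
    move: k1; rewrite (diam_fin (Bb k)) poweR_EFin lte_fin lee_fin => k1.
    have : 1 `^ t <= fine (diam (B k)) `^ t by apply: le_powR => //; exact: ltW.
    by rewrite powR1.
  rewrite ge_min; apply/orP; right.
  apply: ereal_inf_le; exists (\sum_(0 <= k <oo) (diam (B k) `^ s))%E; first by exists B.
  apply: lee_nneseries => [*|k _]; first exact: poweR_ge0.
  have d1 : fine (diam (B k)) <= 1.
    rewrite leNgt; apply/negP => k1; apply: small; exists k.
    by rewrite (diam_fin (Bb k)) lte_fin.
  rewrite (diam_fin (Bb k)) !poweR_EFin lee_fin.
  have := fine_ge0 (diam_ge0 (B k)); rewrite le_eqVlt => /predU1P [<-|d0].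
    by rewrite !powR0 // gt_eqF // (lt_le_trans t0).
  by apply: ger_powR => //; rewrite d0.
by apply: lt_le_trans; rewrite lt_min hs andbT lte_fin.
Qed.

End content_exponents.

(** * Limsup sets in shrinking rectangles *)

Section rectangles.
Context (R : realType) (d : nat) (X : 'I_d.+1 -> pointedMetricType R).
Variables (delta : 'I_d.+1 -> R) (mx : {measure set (borel (maxprod X)) -> \bar R}).
Let m (A : set (maxprod X)) : R := fine (mx A).
Variables (CU CL r0 : R).
Hypotheses (cptX : compact [set: maxprod X]) (mxT : (mx [set: maxprod X] < +oo)%E)
  (delta_ge0 : forall i, 0 <= delta i)
  (CL_gt0 : 0 < CL) (CU_gt0 : 0 < CU) (r0_gt0 : 0 < r0) (r0_le1 : r0 <= 1)
  (rect_up : forall z rho, (forall i, 0 < rho i) ->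
    m (rect z rho) <= CU * \prod_i rho i `^ delta i)
  (rect_lo : forall z rho, (forall i, 0 < rho i <= r0) ->
    CL * \prod_i rho i `^ delta i <= m (rect z rho)).
Let D := \sum_i delta i.

Lemma rect_mass : mass m.
Proof. exact: fine_measure_mass. Qed.

Lemma rect_ball_up x r : 0 < r -> m (ball x r) <= CU * r `^ D.
Proof. by move=> rr; rewrite ball_rect // -powR_sum //; apply: rect_up. Qed.

Lemma rect_ball_lo x r : 0 < r <= r0 -> CL * r `^ D <= m (ball x r).
Proof.
move=> rr; have r_gt0 : 0 < r by case/andP: rr.
by rewrite ball_rect // -powR_sum //; apply: rect_lo.
Qed.

Variables (a : 'I_d.+1 -> R) (z : nat -> maxprod X) (r : nat -> R).
Hypotheses (a_gt0 : forall i, 0 < a i)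
  (a_mono : forall i j : 'I_d.+1, (i <= j)%N -> a i <= a j)
  (r_gt0 : forall n, 0 < r n)
  (r_cvg0 : r n @[n --> \oo] --> (0 : R)).

Let rho n i := r n `^ a i.
Let alpha := \sum_i a i * delta i.
Let amax := a ord_max.

Lemma rho_gt0 n i : 0 < rho n i. Proof. exact: powR_gt0. Qed.

Lemma prod_rho n : \prod_i rho n i `^ delta i = r n `^ alpha.
Proof. by rewrite -powR_sum //; apply: eq_bigr => i _; rewrite /rho -powRrM. Qed.

Lemma amax_gt0 : 0 < amax. Proof. exact: a_gt0. Qed.

Lemma a_le_amax i : a i <= amax.
Proof. by apply: a_mono; rewrite -ltnS. Qed.

Lemma r_small e : 0 < e -> exists N, forall n, (N <= n)%N -> r n <= e.
Proof.
move=> e0; have [N _ NP] := (cvgrPdist_le _ _).1 r_cvg0 e e0.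
by exists N => n /NP /=; rewrite sub0r normrN gtr0_norm.
Qed.

Lemma rho_small e : 0 < e ->
  exists N, forall n, (N <= n)%N -> r n <= 1 /\ forall i, rho n i <= e.
Proof.
move=> e0; have [x0 x00 x0P] := powR_small (a_gt0 ord0) e0.
have [|N NP] := @r_small (Num.min x0 1); first by rewrite lt_min x00 ltr01.
exists N => n /NP; rewrite le_min => /andP [rx r1]; split => // i.
apply: (@le_trans _ _ (r n `^ a ord0)); last by apply: x0P; rewrite (ltW (r_gt0 n)).
by apply: ger_powR; [rewrite r_gt0 r1|apply: a_mono].
Qed.

Lemma rect_rho_up n : m (rect (z n) (rho n)) <= CU * r n `^ alpha.
Proof. by rewrite -prod_rho; apply: rect_up => i; exact: rho_gt0. Qed.

Lemma rect_rho_lo n : (forall i, rho n i <= r0) ->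
  CL * r n `^ alpha <= m (rect (z n) (rho n)).
Proof.
by move=> h; rewrite -prod_rho; apply: rect_lo => i; rewrite rho_gt0 h.
Qed.

Variables (E : nat -> set (maxprod X)) (c s : R).
Hypotheses (E_open : forall n, open (E n))
  (E_sub : forall n, E n `<=` rect (z n) (rho n))
  (E_diam : forall n, (diam (E n) <= (r n `^ amax)%:E)%E)
  (c_gt0 : 0 < c) (s_gt0 : 0 < s)
  (E_content : forall n,
    ((c * m (rect (z n) (rho n)))%:E < hausdorff_content s (E n))%E).

(** The diameter bounds the content of E_n by 4^s r_n^(amax s), the hypothesis bounds it below by c
    CL r_n^alpha once the sides are at most [r0]; a smaller [alpha] is contradicted as r_n tends to
    0. *)
Lemma exponent_le : amax * s <= alpha.
Proof.
rewrite leNgt; apply/negP => lt_as.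
pose e := c * CL / 4 `^ s / 2.
have s4 : 0 < (4 : R) `^ s by exact: powR_gt0.
have e0 : 0 < e by rewrite !divr_gt0 // mulr_gt0.
have [|//|x0 x00 x0P] := @powR_small R (amax * s - alpha) e; first by rewrite subr_gt0.
have [N1 N1P] := rho_small r0_gt0; have [N2 N2P] := r_small x00.
pose n := maxn N1 N2.
have [_ rho_r0] := N1P n (leq_maxl _ _).
have {}x0P : r n `^ (amax * s - alpha) <= e.
  by apply: x0P; rewrite (ltW (r_gt0 n)) N2P // leq_maxr.
have ra0 : 0 < r n `^ alpha by exact: powR_gt0.
have := lt_le_trans (E_content n) (content_le_diam s_gt0 (powR_gt0 amax (r_gt0 n)) (E_diam n)).
rewrite lte_fin powRM ?powR_ge0 // -powRrM.
have -> : amax * s = alpha + (amax * s - alpha) by ring.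
rewrite powRDgt0 //; apply/negP; rewrite -leNgt.
apply: (@le_trans _ _ (c * (CL * r n `^ alpha))); last by rewrite ler_pM2l // rect_rho_lo.
apply: (@le_trans _ _ (4 `^ s * (r n `^ alpha * e))).
  by rewrite ler_pM2l // ler_pM2l.
have -> : 4 `^ s * (r n `^ alpha * e) = c * (CL * r n `^ alpha) / 2.
  by rewrite /e; field; rewrite gt_eqF.
have : 0 < c * (CL * r n `^ alpha) by rewrite !mulr_gt0.
lra.
Qed.

Lemma alpha_le : alpha <= amax * D.
Proof.
rewrite mulr_sumr; apply: ler_sum => i _; apply: ler_wpM2r => //.
exact: a_le_amax.
Qed.

Lemma s_le_D : s <= D.
Proof.
by rewrite -(ler_pM2l amax_gt0); apply: le_trans exponent_le alpha_le.
Qed.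

Lemma alpha_gt0 : 0 < alpha.
Proof. by apply: lt_le_trans exponent_le; rewrite mulr_gt0 // amax_gt0. Qed.

Lemma rect_constE : CU = CU / CL * CL.
Proof. by rewrite divfK // gt_eqF. Qed.

Lemma rect_const_ge1 : 1 <= CU / CL.
Proof.
rewrite ler_pdivlMr // mul1r -(ler_pM2r (powR_gt0 D r0_gt0)).
apply: le_trans (rect_ball_up point r0_gt0); apply: rect_ball_lo.
by rewrite r0_gt0 lexx.
Qed.

(** [s] may equal [D], whereas Frostman's lemma wants an exponent below [D]. Lowering [s] to s'
    keeps the content bound as soon as c m(R_n) < 1. Totals are scaled to a fixed proportion of
    m(R_n), so that sums over rectangles are directly comparable with m. *)
Lemma frostman_pieces s' : 0 < s' < s -> exists2 kappa, 0 < kappa <= 1 &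
  exists N, forall n, (N <= n)%N -> exists mu,
    [/\ mass_in m (E n) mu, growth mu 1 s' &
        mu setT = kappa * m (rect (z n) (rho n))].
Proof.
move=> /andP [s'0 s's].
have [CF CF0 CFP] := frostman cptX rect_mass CL_gt0 r0_gt0 rect_const_ge1 rect_constE
  rect_ball_up rect_ball_lo s'0 (lt_le_trans s's s_le_D).
(* This proportion is at most c / CF, so the Frostman mass only has to be scaled down and keeps
   growth constant 1; [c] in the denominator makes it at most 1. *)
exists (c / (c + CF)).
  by rewrite divr_gt0 ?addr_gt0 //= ler_pdivrMr ?addr_gt0 // mul1r lerDl ltW.
have [|x0 x00 x0P] := powR_small alpha_gt0 (_ : 0 < (2 * (c * CU))^-1).
  by rewrite invr_gt0 !mulr_gt0.
have [N1 N1P] := rho_small r0_gt0; have [N2 N2P] := r_small x00.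
exists (maxn N1 N2) => n; rewrite geq_max => /andP [/N1P [_ rho_r0] /N2P rx0].
pose v := m (rect (z n) (rho n)).
have v0 : 0 < v.
  by apply: lt_le_trans (rect_rho_lo rho_r0); rewrite mulr_gt0 // powR_gt0.
have cv1 : c * v < 1.
  apply: (@le_lt_trans _ _ (c * (CU * (2 * (c * CU))^-1))).
    rewrite ler_pM2l //; apply: le_trans (rect_rho_up n) _.
    by rewrite ler_pM2l // x0P // (ltW (r_gt0 n)).
  rewrite (_ : _ * _ = 2^-1); first lra.
  by field; rewrite !gt_eqF.
have [nu [nuin nug nuT]] := CFP (E n) (c * v) (@E_open n)
  (content_exponent_lt s'0 (ltW s's) cv1 (@E_content n)).
have nuT0 : 0 < nu setT.
  by rewrite -(pmulr_rgt0 _ CF0); apply: lt_le_trans nuT; rewrite mulr_gt0.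
pose k := c / (c + CF) * v / nu setT.
have k0 : 0 <= k by rewrite !mulr_ge0 ?invr_ge0 // ?addr_ge0 // ltW.
have k1 : k <= 1.
  rewrite ler_pdivrMr // mul1r mulrAC ler_pdivrMr ?addr_gt0 //.
  by apply: le_trans nuT _; rewrite mulrC ler_pM2l // lerDr ltW.
exists (fun A => k * nu A); split.
- exact: mass_inZ.
- move=> y q q0; apply: le_trans (nug y q q0).
  have [nuM _ _] := nuin; rewrite ler_piMl //; apply: mass_ge0 => //.
  exact: borel_ball.
- by rewrite /k divfK // gt_eqF.
Qed.

Notation rect1 n := (rect (z n) (rho n)).
Notation rect2 n := (rect (z n) (fun i => 2 * rho n i)).

(** 1 is the growth constant of a piece, used below the shortest side of its rectangle; [CU] is used
    above it. *)
Let C4 := (CU + 1) / CL.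

(* For [r n `^ amax <= q <= 1] one has [max (rho n i) q <= q `^ (a i / amax)]
   and [alpha / amax >= s'], which bounds the measure of the rectangle by the
   measure of its part close to [y]. *)
Lemma local_estimate s' n (mu : set (maxprod X) -> R) y q :
  s' <= s -> r n <= 1 -> 0 < q <= r0 -> mass mu -> growth mu 1 s' ->
  mu setT <= m (rect1 n) -> rect1 n `&` ball y q !=set0 ->
  mu (ball y q) <= C4 * q `^ (s' - D) * m (rect2 n `&` ball y (2 * q)).
Proof.
move=> s's rn1 /andP [q0 qr0] muM mug muT [p [/rectP pz /ball_mdistP yp]].
(* The rectangle with centre [p] and sides [sig] lies in both the doubled rectangle and
   [ball y (2 * q)], so [V] bounds the measure of their intersection from below. *)
pose sig i := Num.min (rho n i) q; pose V := \prod_i sig i `^ delta i.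
have q1 : q <= 1 by exact: le_trans r0_le1.
have sig_gt0 i : 0 < sig i by rewrite lt_min rho_gt0.
have Vge0 : 0 <= V by apply: prodr_ge0 => i _; exact: powR_ge0.
have mb2 : borel_set (rect2 n `&` ball y (2 * q)).
  by apply: borel_setI; [apply: borel_open; exact: open_rect|exact: borel_ball].
have VP : CL * V <= m (rect2 n `&` ball y (2 * q)).
  have sig_r0 i : 0 < sig i <= r0 by rewrite sig_gt0 /= ge_min qr0 orbT.
  apply: (le_trans (@rect_lo p sig sig_r0)).
  apply: (le_mass rect_mass) => //; first by apply: borel_open; exact: open_rect.
  move=> w /rectP pw; split.
    apply/rectP => i; have := pz i; have := pw i; rewrite lt_min => /andP [h _].
    by have := metric_triangle (z n i) (p i) (w i); lra.
  apply/ball_mdistP; have h : mdist p w < q.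
    apply/maxprod_mdist_ltP => // i.
    by have := pw i; rewrite lt_min => /andP [].
  have := metric_triangle y p w; lra.
have qs0 : 0 <= q `^ (s' - D) by exact: powR_ge0.
suff h : mu (ball y q) <= (CU + 1) * (q `^ (s' - D) * V).
  apply: (le_trans h); rewrite (_ : _ * (_ * V) = C4 * q `^ (s' - D) * (CL * V)).
    by apply: ler_wpM2l VP; rewrite mulr_ge0 // divr_ge0 ?addr_ge0 // ltW.
  by rewrite /C4; field; rewrite gt_eqF.
have W0 : 0 <= q `^ (s' - D) * V by exact: mulr_ge0.
have [qle|qgt] := leP q (r n `^ amax).
  have sigE i : sig i = q.
    apply/min_idPr; apply: le_trans qle _.
    by apply: ger_powR; [rewrite r_gt0|exact: a_le_amax].
  have VE : V = q `^ D.
    by rewrite /V (eq_bigr (fun i => q `^ delta i)) ?powR_sum // => i _; rewrite sigE.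
  have E1 : q `^ s' = q `^ (s' - D) * V by rewrite VE -powRDgt0 // subrK.
  have := mug y q q0; rewrite E1 mul1r => /le_trans; apply.
  by rewrite ler_peMl // lerDr ltW.
apply: (@le_trans _ _ (CU * (q `^ (s' - D) * V))); last first.
  by apply: ler_wpM2r => //; rewrite lerDl.
apply: (@le_trans _ _ (mu setT)).
  by apply: le_mass => //; [exact: borel_ball|exact: borel_setT].
apply: (le_trans muT); apply: (le_trans (@rect_up (z n) (rho n) (rho_gt0 n))).
rewrite ler_pM2l //.
pose e i := a i / amax.
have e1 i : e i <= 1 by rewrite ler_pdivrMr ?amax_gt0 // mul1r a_le_amax.
have key i : rho n i <= sig i * q `^ (e i - 1).
  rewrite /sig; have [rq|qr] := leP (rho n i) q.
    rewrite ler_peMr ?(ltW (rho_gt0 n i)) //.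
    have : q `^ 0 <= q `^ (e i - 1).
      by apply: ger_powR; rewrite ?q0 ?q1 ?subr_le0.
    by rewrite powRr0.
  have -> : q * q `^ (e i - 1) = q `^ (e i).
    by rewrite -{1}[q]powRr1 ?(ltW q0) // -powRDgt0 // addrC subrK.
  have -> : rho n i = (r n `^ amax) `^ e i.
    by rewrite -powRrM /e mulrCA divff ?mulr1 // gt_eqF // amax_gt0.
  apply: le_powR; [|exact: powR_ge0|exact: ltW].
  by rewrite divr_ge0 // ltW // amax_gt0.
apply: (@le_trans _ _ (\prod_i ((q `^ (e i - 1)) `^ delta i * sig i `^ delta i))).
  apply: ler_prod => i _; rewrite powR_ge0 /= -powRM ?powR_ge0 ?(ltW (sig_gt0 i)) //.
  by rewrite mulrC; apply: le_powR => //; rewrite ltW // rho_gt0.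
rewrite big_split /= -/V ler_wpM2r //.
rewrite (eq_bigr (fun i => q `^ ((e i - 1) * delta i))) => [|i _]; last by rewrite powRrM.
rewrite powR_sum //; apply: ger_powR; first by rewrite q0.
have -> : \sum_i (e i - 1) * delta i = alpha / amax - D.
  rewrite /alpha mulr_suml /D -sumrB; apply: eq_bigr => i _.
  by rewrite /e; ring.
rewrite lerB // ler_pdivlMr ?amax_gt0 //; apply: le_trans exponent_le.
by rewrite mulrC ler_pM2l // amax_gt0.
Qed.

(** Each piece is charged to the part of its own doubled rectangle near the ball; these parts are
    disjoint, so the charges add up to at most the measure of one enlarged ball. At scales
    [q >= tau] a rectangle meeting [ball y q] lies entirely in [ball y (3 * q)], and no growth
    estimate is needed. *)
Lemma combine_pieces s' O (u : nat -> option nat) kappa tau :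
  s' <= s -> 0 <= kappa <= 1 ->
  (forall k n, u k = Some n -> [/\ r n <= 1, forall i, rho n i <= tau &
     exists mu, [/\ mass_in m (O `&` rect1 n) mu, growth mu 1 s' &
       mu setT = kappa * m (rect1 n)]]) ->
  (forall k l n n', (l < k)%N -> u k = Some n -> u l = Some n' ->
     rect2 n `&` rect2 n' = set0) ->
  forall K, exists mu, [/\ mass_in m O mu,
    mu setT = kappa * \sum_(k < K) (if u k is Some n then m (rect1 n) else 0),
    forall y q, 0 < q <= r0 -> mu (ball y q) <= C4 * q `^ (s' - D) * m (ball y (2 * q)) &
    forall y q, 0 < q -> tau <= q -> mu (ball y q) <= m (ball y (3 * q))].
Proof.
move=> s's /andP [kappa0 kappa1] uP udis K.
have mM := rect_mass.
have C40 : 0 <= C4 by rewrite divr_ge0 ?addr_ge0 // ltW.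
pose S k := if u k is Some n then rect2 n else set0.
have mS k : borel_set (S k).
  rewrite /S; case: (u k) => [n|]; last exact: borel_set0.
  by apply: borel_open; exact: open_rect.
pose W K := \bigcup_(k < K) S k.
have mW L : borel_set (W L) by exact: (mass_bigcup_le mM L mS).1.
have mb (y : maxprod X) q : borel_set (ball y q) by exact: borel_ball.
(* The induction needs the stronger bound by the part of [m] in the doubled rectangles used so far;
   a bound by whole balls would not add up. *)
suff [mu [muin muT mu1 mu2]] : exists mu, [/\ mass_in m O mu,
    mu setT = kappa * \sum_(k < K) (if u k is Some n then m (rect1 n) else 0),
    forall y q, 0 < q <= r0 ->
      mu (ball y q) <= C4 * q `^ (s' - D) * m (W K `&` ball y (2 * q)) &
    forall y q, 0 < q -> tau <= q -> mu (ball y q) <= m (W K `&` ball y (3 * q))].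
  exists mu; split => // y q q0.
    apply: le_trans (mu1 y q q0) _; apply: ler_wpM2l.
      by rewrite mulr_ge0 // powR_ge0.
    by apply: (le_mass mM); [exact: borel_setI|exact: mb|exact: subIsetr].
  move=> tq; apply: le_trans (mu2 y q q0 tq) _.
  by apply: (le_mass mM); [exact: borel_setI|exact: mb|exact: subIsetr].
elim: K => [|K [mu [muin muT mu1 mu2]]].
  have m0 B : borel_set B -> 0 <= m (W 0%N `&` B).
    by move=> mB; apply: (mass_ge0 mM); exact: borel_setI.
  exists (fun=> 0); split; first exact: mass_in0.
  - by rewrite big_ord0 mulr0.
  - move=> y q _; apply: mulr_ge0; last exact: m0.
    by apply: mulr_ge0 => //; exact: powR_ge0.
  - by move=> y q _ _; exact: m0.
have WS : W K.+1 = W K `|` S K by rewrite /W !bigcup_mkord big_ord_recr.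
case E1 : (u K) => [n|]; last first.
  have WE : W K.+1 = W K by rewrite WS /S E1 setU0.
  by exists mu; split => //; rewrite ?big_ord_recr ?E1 /= ?addr0 ?WE.
have [rn1 rho_tau [nu [nuin nug nuT]]] := uP _ _ E1.
have [muM _ _] := muin; have [nuM _ [J [cJ JO J0]]] := nuin.
have SE : S K = rect2 n by rewrite /S E1.
have WD B : borel_set B -> m (W K.+1 `&` B) = m (W K `&` B) + m (rect2 n `&` B).
  move=> mB; rewrite WS setIUl SE mM.2 //.
  - exact: borel_setI.
  - by apply: borel_setI => //; rewrite -SE.
  rewrite setIACA (_ : W K `&` _ = set0) ?set0I //.
  rewrite -subset0 => w [[l /= lK +] nw]; rewrite /S; case E2 : (u l) => [n'|//].
  move=> n'w; have : (rect2 n `&` rect2 n') w by [].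
  by rewrite (udis _ _ _ _ lK E1 E2).
have m1 : borel_set (rect1 n) by apply: borel_open; exact: open_rect.
have far y q : ~ (rect1 n `&` ball y q !=set0) -> nu (ball y q) = 0.
  move=> no; apply: (mass_disjoint_support nuM (borel_closed cJ) J0) => //.
  by rewrite -subset0 => w [yw /JO [_ w1]]; apply: no; exists w.
have nuT1 : nu setT <= m (rect1 n) by rewrite nuT ler_piMl // (mass_ge0 mM).
have m2 B : borel_set B -> 0 <= m (rect2 n `&` B).
  by move=> mB; apply: (mass_ge0 mM); apply: borel_setI => //; rewrite -SE.
exists (fun A => mu A + nu A); split.
- apply: mass_inD => //; apply: mass_inS nuin; exact: subIsetl.
- by rewrite big_ord_recr E1 /= mulrDr muT nuT.
- move=> y q q0; rewrite WD // mulrDr; apply: lerD; first exact: mu1.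
  have [near|/far ->] := pselect (rect1 n `&` ball y q !=set0).
    exact: local_estimate.
  apply: mulr_ge0; last exact: m2.
  by apply: mulr_ge0 => //; exact: powR_ge0.
move=> y q q0 tq; rewrite WD //; apply: lerD; first exact: mu2.
have [[p [/rectP zp /ball_mdistP yp]]|/far ->] :=
  pselect (rect1 n `&` ball y q !=set0); last exact: m2.
apply: (@le_trans _ _ (nu setT)); first by apply: le_mass => //; exact: borel_setT.
apply: (le_trans nuT1); apply: (le_mass mM) => //.
  by apply: borel_setI => //; rewrite -SE.
move=> w /rectP zw; split.
  apply/rectP => i; have := zw i; have := rho_gt0 n i; lra.
apply/ball_mdistP; have h : mdist p w < 2 * q.
  apply/maxprod_mdist_ltP; first by rewrite mulr_gt0.
  move=> i; have := zw i; have := zp i; have := rho_tau i.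
  have := metric_triangle (p i) (z n i) (w i); rewrite (metric_sym (p i) (z n i)); lra.
have := metric_triangle y p w; lra.
Qed.

Hypothesis limsup_full : mx (lim_sup_set (fun n => rect1 n)) = mx [set: maxprod X].

Lemma limsup_meets_mass B : borel_set B ->
  m B = m (B `&` lim_sup_set (fun n => rect1 n)).
Proof.
move=> mB; have mM := rect_mass; pose L := lim_sup_set (fun n => rect1 n).
have mL : borel_set L.
  apply: bigcapT_measurable => n; apply: bigcup_measurable => k _.
  by apply: borel_open; exact: open_rect.
have mT : borel_set [set: maxprod X] by exact: borel_setT.
have mLC : borel_set (setT `\` L) by exact: borel_setD.
have LC0 : m (setT `\` L) = 0.
  have := mass_split mM mT mL; rewrite setTI /m limsup_full; lra.
rewrite (mass_split mM mB mL) -/L.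
suff -> : m (B `\` L) = 0 by rewrite addr0.
have mBL : borel_set (B `\` L) by exact: borel_setD.
apply/eqP; rewrite eq_le (mass_ge0 mM) // andbT.
by rewrite -LC0; apply: (le_mass mM) => // y [].
Qed.

(** Vitali's selection works for these anisotropic rectangles with [r n] as size: r_n <= 2 r_j makes
    every side of R_n at most 2^amax times that of R_j. The half ball leaves room for small
    rectangles to stay in [ball x q]. *)
Lemma rect_selection : exists2 c6, 0 < c6 & forall x q N, 0 < q <= r0 ->
  exists u : nat -> option nat, exists K, [/\
    forall k n, u k = Some n -> (N <= n)%N /\ rect1 n `&` ball x (q / 2) !=set0,
    forall k l n n', (l < k)%N -> u k = Some n -> u l = Some n' ->
      rect2 n `&` rect2 n' = set0 &
    c6 * q `^ D <= \sum_(k < K) (if u k is Some n then m (rect1 n) else 0)].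
Proof.
have mM := rect_mass.
(* When the doubled rectangles meet, a point of R_n is, in coordinate i, within 2 rho_j + 3 rho_n of
   the centre of R_j. *)
pose Lam : R := 2 + 3 * 2 `^ amax.
have p2 : 0 < (2 : R) `^ amax by exact: powR_gt0.
have Lam0 : 0 < Lam by rewrite /Lam; lra.
have [N0 N0P] := rho_small r0_gt0.
pose C7 := CU * Lam `^ D / CL.
have C70 : 0 < C7 by rewrite divr_gt0 // mulr_gt0 // powR_gt0.
pose h0 := CL / 2 `^ D / C7.
have D2 : 0 < (2 : R) `^ D by exact: powR_gt0.
have h00 : 0 < h0 by apply: divr_gt0 => //; exact: divr_gt0.
exists (h0 / 2); first by apply: divr_gt0.
move=> x q N /andP [q0 qr0]; pose B := ball x (q / 2).
have q20 : 0 < q / 2 by rewrite divr_gt0.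
pose F n := (maxn N N0 <= n)%N /\ rect1 n `&` B !=set0.
have m1 n : borel_set (rect1 n) by apply: borel_open; exact: open_rect.
have m2 n : borel_set (rect2 n) by apply: borel_open; exact: open_rect.
have FP n : F n -> [/\ (N <= n)%N, r n <= 1 & forall i, rho n i <= r0].
  by move=> [+ _]; rewrite geq_max => /andP [Nn /N0P []].
have mT : borel_set [set: maxprod X] by exact: borel_setT.
have sub12 n : rect1 n `<=` rect2 n.
  move=> w /rectP zw; apply/rectP => i.
  have := zw i; have := rho_gt0 n i; lra.
have Fbd : exists M, forall n, F n -> r n <= M by exists 1 => n /FP [].
have Ffin t : 0 < t -> exists K : nat, forall u : nat -> nat,
    (forall k, (k < K)%N -> F (u k) /\ t <= r (u k)) ->
    exists k l, (l < k < K)%N /\ rect2 (u k) `&` rect2 (u l) !=set0.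
  move=> t0; pose v := CL * t `^ alpha.
  have v0 : 0 < v by rewrite mulr_gt0 // powR_gt0.
  exists (Num.truncn (m setT / v)).+1 => u uP; apply: contrapT => no.
  set K := (Num.truncn _).+1 in uP no.
  have Kv : m setT < K%:R * v by rewrite -ltr_pdivrMr // truncnS_gt.
  have : \sum_(k < K) m (rect2 (u k)) <= m setT.
    apply: (mass_sum_disjoint mM (B := fun k => rect2 (u k))) => // i j ji.
    by apply/eqP; apply: contrapT => /negP/set0P h; apply: no; exists i, j.
  apply/negP; rewrite -ltNge; apply: (lt_le_trans Kv).
  have -> : K%:R * v = \sum_(k < K) v by rewrite sumr_const card_ord mulr_natl.
  apply: ler_sum => k _; have [Fk tk] := uP _ (ltn_ord k).
  have [_ _ kr0] := FP _ Fk.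
  apply: (@le_trans _ _ (m (rect1 (u k)))); last exact: (le_mass mM).
  apply: le_trans (rect_rho_lo kr0); rewrite ler_pM2l //.
  by apply: le_powR; rewrite ?(ltW alpha_gt0) // ltW.
have [u [uF udis ucov]] := vitali_selection
  (meet := fun n k => rect2 n `&` rect2 k !=set0) (fun n _ => r_gt0 n) Fbd Ffin.
exists u; apply: contrapT => no.
have {}udis k l n n' : (l < k)%N -> u k = Some n -> u l = Some n' ->
    rect2 n `&` rect2 n' = set0.
  move=> lk uk ul; apply/eqP; apply: contrapT => /negP/set0P.
  exact: udis lk uk ul.
have sum_lt K : \sum_(k < K) (if u k is Some n then m (rect1 n) else 0) <= h0 / 2 * q `^ D.
  rewrite leNgt; apply/negP => /ltW hK; apply: no; exists K; split => //.
  by move=> k n /uF h; have [] := FP _ h; have [_] := h.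
pose S k := if u k is Some n then rect (z n) (fun i => Lam * rho n i) else set0.
have mS k : borel_set (S k).
  rewrite /S; case: (u k) => [n|]; last exact: borel_set0.
  by apply: borel_open; exact: open_rect.
have Sle k : m (S k) <= C7 * (if u k is Some n then m (rect1 n) else 0).
  rewrite /S; case E1 : (u k) => [n|]; last by rewrite (mass_set0 mM) mulr0.
  have [_ _ nr0] := FP _ (uF _ _ E1).
  have Lr i : 0 < Lam * rho n i by rewrite mulr_gt0 // rho_gt0.
  apply: (le_trans (@rect_up (z n) _ Lr)).
  have -> : \prod_i (Lam * rho n i) `^ delta i = Lam `^ D * r n `^ alpha.
    rewrite -prod_rho -powR_sum // -big_split /=; apply: eq_bigr => i _.
    by rewrite powRM ?(ltW Lam0) // ltW // rho_gt0.
  rewrite (_ : _ * _ = C7 * (CL * r n `^ alpha)).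
    by rewrite ler_pM2l // rect_rho_lo.
  by rewrite /C7; field; rewrite gt_eqF.
have cover : B `&` lim_sup_set (fun n => rect1 n) `<=` \bigcup_k S k.
  move=> w [Bw Lw]; have [n /= Nn nw] := Lw (maxn N N0) I.
  have Fn : F n by split => //; exists w.
  have [k [j [uk [p [/rectP np /rectP jp]] rnj]]] := ucov n Fn.
  exists k => //; rewrite /S uk; apply/rectP => i.
  have rho_le : rho n i <= 2 `^ amax * rho j i.
    apply: (@le_trans _ _ ((2 * r j) `^ a i)).
      by apply: le_powR => //; exact: ltW.
    rewrite powRM ?(ltW (r_gt0 j)) // ler_wpM2r ?powR_ge0 //.
    by apply: ler_powR; [lra|exact: a_le_amax].
  move/rectP: nw => /(_ i) nw; have := np i; have := jp i.
  have := metric_triangle (z j i) (p i) (w i).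
  have := metric_triangle (p i) (z n i) (w i); rewrite (metric_sym (p i) (z n i)).
  have -> : Lam * rho j i = 2 * rho j i + 3 * (2 `^ amax * rho j i).
    by rewrite /Lam; ring.
  lra.
have mL : borel_set (lim_sup_set (fun n => rect1 n)).
  apply: bigcapT_measurable => n; apply: bigcup_measurable => k _.
  exact: m1.
have mB : borel_set B by exact: borel_ball.
have mBL := borel_setI mB mL.
have : m B <= C7 * (h0 / 2 * q `^ D).
  rewrite limsup_meets_mass // -lee_fin (fine_measureK mxT mBL).
  (* The enlarged rectangles cover almost all of the half ball only as a countable family, so
     countable subadditivity of [mx] itself is used. Partial sums below [c6] times q^D would leave
     the half ball at most half of its least measure. *)
  apply: le_trans (measure_sigma_subadditive mx mS mBL cover) _.
  apply: lime_le; first by apply: is_cvg_nneseries => *; exact: measure_ge0.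
  near=> n; rewrite big_mkord.
  under eq_bigr do rewrite -(fine_measureK mxT (mS _)).
  rewrite sumEFin lee_fin.
  apply: (@le_trans _ _ (\sum_(k < n) C7 *
      (if u k is Some j then m (rect1 j) else 0))).
    by apply: ler_sum => k _; exact: Sle.
  by rewrite -mulr_sumr ler_pM2l.
apply/negP; rewrite -ltNge; apply: lt_le_trans (rect_ball_lo x _); last first.
  by rewrite q20 /=; lra.
rewrite powR_div ?(ltW q0) //.
have -> : C7 * (h0 / 2 * q `^ D) = CL * (q `^ D / 2 `^ D) / 2.
  by rewrite /h0; field; rewrite !gt_eqF.
have : 0 < CL * (q `^ D / 2 `^ D) by rewrite mulr_gt0 // divr_gt0 // powR_gt0.
lra.
Unshelve. all: by end_near. Qed.

(** The total mass is at least of order q^D, so after normalisation a bound by p^t q^(D - t) is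
    needed for balls of radius p < q. Down to [tau] it follows from comparison with m; below [tau]
    the pieces give p^s', and the surplus p^(s' - t) is at most q^(D - t). *)
Lemma limsup_spreads t N : 0 < t < s ->
  spreads m r0 (\bigcup_(n in [set n | (N <= n)%N]) E n) t.
Proof.
move=> /andP [t0 ts]; have mM := rect_mass.
pose s' := (t + s) / 2; have [ts' s's] : t < s' /\ s' < s by rewrite /s'; lra.
have s'0 : 0 < s' < s by rewrite s's (lt_trans t0).
have [kappa /andP [kappa0 kappa1] [N1 piece]] := frostman_pieces s'0.
have [c6 c60 sel] := rect_selection.
have tD : t <= D by apply: ltW; exact: lt_le_trans s_le_D.
have C40 : 0 <= C4 by rewrite divr_ge0 ?addr_ge0 // ltW.
pose b1 := CU * 3 `^ D; pose b2 := C4 * CU * 2 `^ D.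
have b10 : 0 <= b1 by rewrite mulr_ge0 ?powR_ge0 // ltW.
have b20 : 0 <= b2.
  by rewrite /b2 mulr_ge0 ?powR_ge0 // mulr_ge0 // ltW.
have kc : 0 < kappa * c6 by exact: mulr_gt0.
(* The summand 1 serves the balls of radius at least [q], where the total mass suffices. *)
exists (1 + (b1 + b2) / (kappa * c6)).
  by rewrite ltr_wpDr // divr_ge0 ?addr_ge0 // ltW.
move=> x q /andP [q0 qr0].
have [||x0 x00 x0P] := @powR_small R (s' - t) (q `^ (D - t)).
- by rewrite subr_gt0.
- exact: powR_gt0.
(* Rectangles with sides at most [q / 4] that meet the ball of radius [q / 2] stay inside
   [ball x q]; [x0] makes the surplus exponent effective. *)
pose tau := Num.min x0 (Num.min (q / 4) r0).
have tau0 : 0 < tau by rewrite !lt_min x00 r0_gt0 divr_gt0.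
have [taux tauq taur] : [/\ tau <= x0, tau <= q / 4 & tau <= r0].
  by split; rewrite !ge_min lexx ?orbT.
have [N2 N2P] := rho_small tau0.
have qq : 0 < q <= r0 by rewrite q0.
have [u [K [uP udis usum]]] := sel x q (maxn N (maxn N1 N2)) qq.
pose O := (\bigcup_(n in [set n | (N <= n)%N]) E n) `&` ball x q.
have [||mu [muin muT mu1 mu2]] := @combine_pieces s' O u kappa tau (ltW s's) _ _ udis K.
- by rewrite (ltW kappa0).
- move=> k n uk; have [+ [p [/rectP zp /ball_mdistP xp]]] := uP _ _ uk.
  rewrite !geq_max => /and3P [Nn N1n /N2P [rn1 rho_tau]]; split => //.
  have [nu [nuin nug nuT]] := piece n N1n; exists nu; split => //.
  apply: mass_inS nuin => w Ew; have rw := E_sub Ew; split => //.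
  split; first by exists n.
  apply/ball_mdistP; have h : mdist p w < 2 * tau.
    apply/maxprod_mdist_ltP; first by rewrite mulr_gt0.
    move/rectP: rw => rw i; have := rw i; have := zp i; have := rho_tau i.
    have := metric_triangle (p i) (z n i) (w i); rewrite (metric_sym (p i) (z n i)); lra.
  have := metric_triangle x p w; lra.
set m0 := mu setT in muT; have m00 : kappa * c6 * q `^ D <= m0.
  by rewrite muT -mulrA ler_pM2l.
have qD0 : 0 < q `^ D by exact: powR_gt0.
have m0_gt0 : 0 < m0 by apply: lt_le_trans m00; exact: mulr_gt0.
have [muM _ _] := muin.
have growth_mu y p : 0 < p < q -> mu (ball y p) <= (b1 + b2) * (p `^ t * q `^ (D - t)).
  move=> /andP [p0 pq]; have pt0 : 0 <= p `^ t by exact: powR_ge0.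
  have qDt0 : 0 <= q `^ (D - t) by exact: powR_ge0.
  have pqt0 : 0 <= p `^ t * q `^ (D - t) by exact: mulr_ge0.
  have [taup|ptau] := leP tau p.
    apply: (le_trans (mu2 y p p0 taup)).
    apply: (@le_trans _ _ (b1 * (p `^ t * q `^ (D - t)))); last first.
      by apply: ler_wpM2r => //; rewrite lerDl.
    have p30 : 0 < 3 * p by rewrite mulr_gt0.
    apply: (le_trans (rect_ball_up y p30)).
    rewrite powRM ?(ltW p0) // mulrA ler_wpM2l //.
    have -> : p `^ D = p `^ t * p `^ (D - t) by rewrite -powRDgt0 // addrC subrK.
    apply: ler_wpM2l => //; apply: le_powR; rewrite ?subr_ge0 //; exact: ltW.
  have pr0 : 0 < p <= r0 by rewrite p0 (le_trans (ltW ptau)).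
  apply: (le_trans (mu1 y p pr0)).
  apply: (@le_trans _ _ (b2 * (p `^ t * q `^ (D - t)))); last first.
    by apply: ler_wpM2r => //; rewrite lerDr.
  have p20 : 0 < 2 * p by rewrite mulr_gt0.
  have Cp : 0 <= C4 * p `^ (s' - D) by rewrite mulr_ge0 ?powR_ge0.
  apply: (le_trans (ler_wpM2l Cp (rect_ball_up y p20))).
  have -> : C4 * p `^ (s' - D) * (CU * (2 * p) `^ D) = b2 * (p `^ t * p `^ (s' - t)).
    rewrite powRM ?(ltW p0) //.
    have -> : p `^ t * p `^ (s' - t) = p `^ s' by rewrite -powRDgt0 // addrC subrK.
    have -> : p `^ s' = p `^ (s' - D) * p `^ D by rewrite -powRDgt0 // subrK.
    by rewrite /b2; ring.
  apply: ler_wpM2l => //; apply: ler_wpM2l => //; apply: x0P.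
  by rewrite (ltW p0) /= (le_trans (ltW ptau)).
exists (fun A => m0^-1 * mu A); split.
- by apply: mass_inZ => //; rewrite invr_ge0 ltW.
- by rewrite mulVf // gt_eqF.
move=> y p p0; have qt0 : 0 < q `^ t by exact: powR_gt0.
rewrite mulrC ler_pdivrMr //.
have pt0 : 0 <= p `^ t by exact: powR_ge0.
have bk0 : 0 <= (b1 + b2) / (kappa * c6) by rewrite divr_ge0 ?addr_ge0 // ltW.
have [qp|pq] := leP q p.
  apply: (@le_trans _ _ m0).
    by apply: le_mass => //; [exact: borel_ball|exact: borel_setT].
  rewrite ler_peMl ?(ltW m0_gt0) // mulrAC ler_pdivlMr // mul1r.
  apply: (@le_trans _ _ (p `^ t)); first by apply: le_powR => //; exact: ltW.
  by rewrite ler_peMl // lerDl.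
apply: le_trans (growth_mu y p _) _; first by rewrite p0.
apply: (@le_trans _ _ ((b1 + b2) / (kappa * c6) / q `^ t * p `^ t * (kappa * c6 * q `^ D))).
  have -> : q `^ D = q `^ t * q `^ (D - t) by rewrite -powRDgt0 // addrC subrK.
  rewrite le_eqVlt; apply/orP; left; apply/eqP; field.
  by rewrite !gt_eqF.
apply: ler_pM => //.
- by rewrite mulr_ge0 // divr_ge0 // ltW.
- by rewrite mulr_ge0 // ltW.
- by apply: ler_wpM2r => //; apply: ler_wpM2r; rewrite ?invr_ge0 ?(ltW qt0) // lerDr.
Qed.

End rectangles.

Theorem theorem2p18 (R : realType) (d : nat)
  (X : 'I_d.+1 -> pointedMetricType R)
  (X_compact : forall i, compact [set: X i])
  (delta : 'I_d.+1 -> R)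
  (m : forall i, {measure set (borel (X i)) -> \bar R})
  (m_regular : forall i, ahlfors_regular (m i) (delta i))
  (mx : {measure set (borel (maxprod X)) -> \bar R})
  (mx_prod : is_product_measure m mx)
  (a : 'I_d.+1 -> R)
  (a_gt0 : forall i, 0 < a i)
  (a_nondecreasing : forall i j : 'I_d.+1, (i <= j)%N -> a i <= a j)
  (z : nat -> forall i, X i) (r : nat -> R)
  (r_gt0 : forall n, 0 < r n)
  (r_cvg0 : r n @[n --> \oo] --> (0 : R))
  (Rn : nat -> set (maxprod X))
  (Rn_def : forall n, Rn n = box (fun i => ball (z n i) (r n `^ a i)))
  (limsup_Rn : mx (lim_sup_set Rn) = mx [set: maxprod X])
  (E : nat -> set (maxprod X))
  (E_open : forall n, open (E n))
  (E_sub : forall n, E n `<=` Rn n)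
  (E_diam : forall n, (diam (E n) <= (r n `^ a ord_max)%:E)%E)
  (c s : R) (c_gt0 : 0 < c) (s_gt0 : 0 < s)
  (E_content : forall n, (c%:E * mx (Rn n) < hausdorff_content s (E n))%E) :
  large_intersection_class s (lim_sup_set E).
Proof.
have [delta0 mxT [cl [Cu [r1 [cl0 Cu0 r10 up lo]]]]] :=
  rect_measure_bounds X_compact m_regular mx_prod.
have cptX := compact_maxprod X_compact.
(* Radii at most 1 make powers decrease with the exponent, as the comparison of exponents inside a
   rectangle requires. *)
pose r0 := Num.min r1 1.
have r00 : 0 < r0 by rewrite lt_min r10 ltr01.
have r01 : r0 <= 1 by rewrite ge_min lexx orbT.
have {}lo z' rho : (forall i, 0 < rho i <= r0) ->
    cl * \prod_i rho i `^ delta i <= fine (mx (rect z' rho)).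
  move=> h; apply: lo => i; have /andP [-> h'] := h i.
  by rewrite (le_trans h') // ge_min lexx.
have RnE n : Rn n = rect (z n : maxprod X) (fun i => r n `^ a i) by exact: Rn_def.
have content n : ((c * fine (mx (rect (z n : maxprod X) (fun i => r n `^ a i))))%:E
    < hausdorff_content s (E n))%E.
  rewrite EFinM fine_measureK -?RnE //.
  by rewrite RnE; apply: borel_open; exact: open_rect.
have sub n : E n `<=` rect (z n : maxprod X) (fun i => r n `^ a i).
  by rewrite -RnE; exact: E_sub.
have full : mx (lim_sup_set (fun n => rect (z n : maxprod X) (fun i => r n `^ a i)))
    = mx [set: maxprod X].
  by rewrite -limsup_Rn; congr (mx (lim_sup_set _)); apply/funext => n.
have sD := s_le_D delta0 cl0 r00 lo a_gt0 a_nondecreasing r_gt0 r_cvg0 E_diam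
  c_gt0 s_gt0 content.
apply: (large_intersection_bigcap cptX (fine_measure_mass mxT) cl0 r00
  (rect_const_ge1 cl0 r00 up lo) (rect_constE _ cl0)
  (rect_ball_up up) (rect_ball_lo lo)).
- by rewrite s_gt0 sD.
- by move=> n; apply: bigcup_open => k _; exact: E_open.
move=> N t ts; exact: (limsup_spreads cptX mxT delta0 cl0 Cu0 r00 r01 up lo a_gt0
  a_nondecreasing r_gt0 r_cvg0 E_open sub E_diam c_gt0 s_gt0 content full).
Qed.
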